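(* As $x\to\infty$, $$N(x) = x\exp\left\{-\sqrt{2}\,L(x)\left(1 + g_0(x) + O\left(\left(\frac{\log_3 x}{\log_2 x}\right)^3\right)\right)\right\},$$ where $$L(x)=\sqrt{\log x\,\log\log x}$$ and, for $r>-1$, $$g_r(x) = \frac{\log_3 x+\log(1+r)-2-\log 2}{2\log_2 x}\left(1+\frac{2}{\log_2 x}\right) - \frac{(\log_3 x + \log(1+r)-\log 2)^2}{8(\log_2 x)^2}$$ (so that $g_0$ is the case $r=0$).
   Context: For an integer $n\ge 2$, $P(n)$ denotes the largest prime factor of $n$. $N(x)$ denotes the number of natural numbers $n$ with $2\le n\le x$ such that $n$ does not divide $P(n)!$. Iterated logarithms: $\log_1 x=\log x$ and $\log_k x=\log(\log_{k-1}x)$ for $k\ge 2$ (so $\log_2 x=\log\log x$, $\log_3 x=\log\log\log x$). The $O$-estimate holds for all sufficiently large $x$ with an absolute implied constant. *)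

(* Defs.v *)
From mathcomp Require Import all_boot all_order all_algebra archimedean.
From mathcomp Require Import all_classical all_reals all_analysis.

Set Implicit Arguments.
Unset Strict Implicit.
Unset Printing Implicit Defensive.

Import Order.TTheory GRing.Theory Num.Theory.
Import numFieldNormedType.Exports.

Local Open Scope ring_scope.

(* The Landau notations need a packaged filter; the library provides the Filter
   instance of +oo but not this packaging. *)
Canonical pinfty_filter_on (R : numFieldType) :=
  FilterType (@pinfty_nbhs R) _.

(* The integers n with 2 <= n <= x are those of index_iota 2 (floor x + 1), and
   for them max_pdiv n is the largest prime factor P(n). *)
Definition N (R : realType) (x : R) : nat :=
  count (fun n => ~~ (n %| (max_pdiv n)`!)%N) (index_iota 2 (Num.truncn x).+1).

(* ln y = 0 for y <= 0, so the values are the usual ones only for x large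
   enough. *)
Definition ilog (R : realType) (k : nat) (x : R) : R := iter k (@ln R) x.

Definition L (R : realType) (x : R) : R := Num.sqrt (ilog 1 x * ilog 2 x).

(* Meant for -1 < r. *)
Definition g (R : realType) (r x : R) : R :=
  (ilog 3 x + ln (1 + r) - 2 - ln 2) / (2 * ilog 2 x) * (1 + 2 / ilog 2 x)
  - (ilog 3 x + ln (1 + r) - ln 2) ^+ 2 / (8 * ilog 2 x ^+ 2).

(* Main.v *)
Require Import Defs.
From mathcomp Require Import all_boot all_order all_algebra archimedean.
From mathcomp Require Import all_classical all_reals all_analysis.
From mathcomp Require Import ring lra zify.

(** Parametrise x by the saddle point t, that is, ln x = E^2/t with E = exp t; every
    large x arises in this way ([saddle_exists]). The theorem follows from

      ln (x / N x) = 2 E - E (1/t + 1/t^2) + O(E/t^3)      ([N_upper], [N_lower])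

    by rewriting t in terms of the iterated logarithms of x: with s = ln t/(2t) one
    has ln ln x = 2t (1-s) and sqrt 2 * L x = 2 E sqrt (1-s), and the expansion of
    both sides up to s^3 gives exactly 1 + g_0 ([expansion_match]).

    Typically n fails to divide P(n)! because p^2 divides n, where p = P(n); the other
    possibility, a smaller prime q whose exponent in n exceeds its exponent in p!,
    forces an even larger divisor p q^a of n ([forced_divisor_ge]). So N x is
    governed by the number of n = p^2 m <= x with m free of primes above p = exp v.
    Rankin's method with exponent 1 - t/v bounds this number by

      (x/p) exp (- v - E^2/v + I(t)),     I(t) = sum over q <= p of q^(- 1 + t/v),

    up to negligible factors, and I(t) is at most E (1/t + 1/t^2 + O(1/t^3))
    independently of v ([tilted_prime_sum_le]). Since v + E^2/v >= 2 E, the same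
    bound holds for all p, and summing 1/p over p costs little.

    The only input about primes is Mertens' first theorem, with a bounded error
    ([mertens_le], [mertens_ge]). It is applied to about t^5 blocks of primes of
    equal length on the logarithmic scale: each block is so long that the error is
    negligible, and so short that the weights are nearly constant on it.

    For the lower bound, v = E is the value for which the inequality above is an
    equality. One takes n = p^2 m r with p just above exp E, where m has a prescribed
    number k_j of prime factors in the j-th block, the number expected under Rankin's
    weights ([block_choice]), and r is a product of few small primes that brings n
    close to x ([fill_count]). For fixed p and m the number of choices of r is nearly
    x/(p^2 m), and the sum of 1/m is the product of S_j^k_j/k_j!, where S_j is
    the sum of 1/q over the block; by Stirling's formula this is exp (I(t) - E) up to
    negligible factors. The sum of 1/p^2 contributes the remaining exp (- E). *)

Set Implicit Arguments.
Unset Strict Implicit.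
Unset Printing Implicit Defensive.

Import Order.TTheory GRing.Theory Num.Theory.
Import numFieldNormedType.Exports.

(** * Elementary bounds on primes and factorials *)

Lemma prod_primes_dvd (a b M : nat) :
  (forall p, prime p -> a <= p < b -> p %| M) ->
  \prod_(a <= p < b | prime p) p %| M.
Proof.
elim: b => [|b IH] H; first by rewrite big_geq.
have [ab|ab] := leqP a b; last by rewrite big_geq ?dvd1n.
have IH' : \prod_(a <= p < b | prime p) p %| M.
  by apply: IH => p pp /andP[ap pb]; apply: H => //; rewrite ap /= ltnW.
rewrite big_mkcond big_nat_recr //= -big_mkcond /=.
case: ifP => [pb|_]; last by rewrite muln1.
rewrite Gauss_dvd ?IH' /=; first by apply: H => //; rewrite ab /=.
rewrite coprime_sym prime_coprime //; apply/negP => bdvd.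
have : b \in \pi(\prod_(a <= p < b | prime p) p).
  rewrite mem_primes pb bdvd andbT /=.
  by rewrite prodn_cond_gt0 // => i /prime_gt0.
rewrite mem_primes => /and3P[_ _].
rewrite big_nat_cond; elim/big_ind: _ => [|x y Hx Hy|i].
- by rewrite dvdn1 => /eqP eb; rewrite eb in pb.
- by rewrite Euclid_dvdM // => /orP[].
- move=> /andP[/andP[_ ib] pi]; rewrite dvdn_prime2 // => /eqP eib.
  by rewrite eib ltnn in ib.
Qed.

Lemma prime_ndvd_fact (p k : nat) : prime p -> k < p -> ~~ (p %| k`!).
Proof.
move=> pp; elim: k => [|k IHk] kp.
  by rewrite fact0 dvdn1; apply/eqP => e; rewrite e in pp.
by rewrite factS Euclid_dvdM // negb_or IHk ?(ltnW kp) // andbT gtnNdvd.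
Qed.

(** The two central coefficients of the row 2m+1 are equal and their sum is at
    most 2^(2m+1). *)
Lemma bin_mid_le (m : nat) : 'C(m.*2.+1, m) <= 4 ^ m.
Proof.
have E : 'C(m.*2.+1, m) = 'C(m.*2.+1, m.+1).
  rewrite -(@bin_sub m.*2.+1 m); last by lia.
  by congr binomial; lia.
have S : 'C(m.*2.+1, m) + 'C(m.*2.+1, m.+1) <= 2 ^ m.*2.+1.
  rewrite -[2]/(1 + 1)%N expnDn.
  have h1 : m < m.*2.+2 by lia.
  have h2 : m.+1 < m.*2.+2 by lia.
  rewrite (bigD1 (Ordinal h1)) //= (bigD1 (Ordinal h2)) /=; last first.
    by apply/eqP => /(congr1 val) /=; lia.
  by rewrite !exp1n !muln1; lia.
have : 2 ^ m.*2.+1 = 2 * 4 ^ m by rewrite expnS -mul2n expnM.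
lia.
Qed.

(** For odd n = 2m+1 the primes above m+1 all divide the binomial coefficient
    C(2m+1, m), which is at most 4^m; the primes up to m+1 are covered by
    induction. *)
Lemma prod_primes_le (n : nat) : \prod_(0 <= p < n.+1 | prime p) p <= 4 ^ n.
Proof.
elim/ltn_ind: n => n IH.
have [n2|n2] := leqP n 2.
  by case: n n2 {IH} => [|[|[|n]]] // _; rewrite big_mkcond !big_nat_recr //= big_geq.
have [on|en] := boolP (odd n); last first.
  case: n n2 en IH => // n n2 en IH.
  rewrite big_mkcond big_nat_recr //= -big_mkcond /= ifN ?muln1; last first.
    apply/negP => /even_prime [h|h]; [lia | by rewrite h in en].
  by apply: leq_trans (IH n _) _ => //; rewrite leq_exp2l.
have -> : n = n./2.*2.+1 by rewrite -[LHS]odd_double_half on.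
set m := n./2; have m0 : 0 < m by rewrite /m; lia.
(* Up to m+1 by induction; from m+2 to 2m+1 through the binomial coefficient. *)
rewrite (@big_cat_nat _ _ _ m.+2) //=; last by lia.
have -> : 4 ^ m.*2.+1 = 4 ^ m.+1 * 4 ^ m by rewrite -expnD; congr expn; lia.
apply: leq_mul; first by apply: IH; rewrite /m; lia.
apply: leq_trans (bin_mid_le m); apply: dvdn_leq; first by rewrite bin_gt0; lia.
apply: prod_primes_dvd => p pp /andP[ap pb].
have := @dvdn_fact p m.*2.+1.
have -> : (0 < p <= m.*2.+1) by lia.
rewrite -(@bin_fact m.*2.+1 m); last by lia.
move=> /(_ isT); rewrite !Euclid_dvdM // => /or3P[] //.
  by rewrite (negPf (prime_ndvd_fact pp _)) //; lia.
by rewrite (negPf (prime_ndvd_fact pp _)) //; lia.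
Qed.

Lemma fact_le_expn (k n : nat) : k <= n -> k`! <= n ^ k.
Proof. by elim: k => // k IH kn; rewrite factS expnS leq_mul // IH // ltnW. Qed.

Local Open Scope classical_set_scope.
Local Open Scope ring_scope.

(** * Mertens' first theorem *)

Section Mertens.
Variable R : realType.
Implicit Types (x y z : R) (n p : nat).

Lemma ln_prod_nat (r : seq nat) (P : pred nat) (F : nat -> nat) :
  (forall i, P i -> (0 < F i)%N) ->
  ln ((\prod_(i <- r | P i) F i)%N%:R : R) = \sum_(i <- r | P i) ln ((F i)%:R : R).
Proof.
move=> F0; suff [] : (0 < (\prod_(i <- r | P i) F i))%N /\
   ln ((\prod_(i <- r | P i) F i)%N%:R : R) = \sum_(i <- r | P i) ln ((F i)%:R : R) by [].
elim/big_rec2: _ => [|i y1 y2 Pi [y10 <-]]; first by rewrite ln1.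
rewrite muln_gt0 F0 //; split=> //.
by rewrite natrM lnM // posrE ltr0n // F0.
Qed.

(** The range of primes is the same for all m <= n, so that these identities
    can be added up to factorise n!. *)
Lemma ln_factored (m n : nat) : (0 < m <= n)%N ->
  ln (m%:R : R) = \sum_(0 <= p < n.+1 | prime p) (logn p m)%:R * ln p%:R.
Proof.
move=> /andP[m0 mn].
have E : m = (\prod_(0 <= p < n.+1 | prime p) p ^ logn p m)%N.
  rewrite (@big_cat_nat _ _ _ m.+1) //= [X in (_ * X)%N]big1_seq ?muln1; last first.
    move=> i /andP[_]; rewrite mem_index_iota => /andP[mi _].
    by rewrite lognE [(i %| m)%N]gtnNdvd // !andbF.
  rewrite -[LHS](partnT m0) /partn [RHS]big_mkcond.
  by apply: eq_bigr => p _; case: ifPn => // np; rewrite lognE (negPf np).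
rewrite [in LHS]E ln_prod_nat; last by move=> i ip; rewrite expn_gt0 prime_gt0.
apply: eq_bigr => p pp; rewrite natrX lnXn ?mulr_natl //.
by rewrite ltr0n prime_gt0.
Qed.

Lemma ln_fact n : ln ((n`!)%:R : R) = \sum_(0 <= p < n.+1 | prime p) (logn p n`!)%:R * ln p%:R.
Proof.
suff H k : (k <= n)%N -> ln ((k`!)%:R : R) = \sum_(0 <= p < n.+1 | prime p) (logn p k`!)%:R * ln p%:R by apply: H.
elim: k => [|k IH] kn.
  by rewrite fact0 ln1 big1 // => p _; rewrite logn1 mul0r.
rewrite factS natrM lnM ?posrE ?ltr0n ?fact_gt0 // IH 1?ltnW // (@ln_factored _ n) //.
rewrite -big_split; apply: eq_bigr => p pp /=.
by rewrite lognM ?fact_gt0 // natrD mulrDl.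
Qed.

Lemma ln_le_subr1 x : 0 < x -> ln x <= x - 1.
Proof.
move=> x0; have -> : ln x = ln (1 + (x - 1)) by congr ln; lra.
by apply: le_ln1Dx; lra.
Qed.

(** Half of Stirling's formula, by induction from n (ln (n+1) - ln n) <= 1. *)
Lemma ln_fact_ge n : n%:R * ln n%:R - n%:R <= ln ((n`!)%:R : R).
Proof.
elim: n => [|n IH]; first by rewrite mul0r subr0 fact0 ln1.
rewrite factS natrM lnM ?posrE ?ltr0n ?fact_gt0 //.
have [->|n0] := posnP n; first by rewrite !ln1; lra.
have h : (n%:R : R) * (ln n.+1%:R - ln n%:R) <= 1.
  have n0' : (0 : R) < n%:R by rewrite ltr0n.
  rewrite -ln_div ?posrE ?ltr0n //.
  have -> : (n.+1%:R / n%:R : R) = 1 + 1 / n%:R.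
    by rewrite -natr1; field; rewrite gt_eqF.
  have : ln (1 + 1 / n%:R) <= (1 / n%:R : R).
    by apply: le_ln1Dx; apply: lt_trans (ltrN10 _) _; rewrite divr_gt0.
  by move=> h; rewrite mulrC -ler_pdivlMr.
rewrite -natr1 in h *; lra.
Qed.

Lemma ln_fact_le n : ln ((n`!)%:R : R) <= n%:R * ln n%:R.
Proof.
have [->|n0] := posnP n; first by rewrite fact0 ln1 mul0r.
rewrite mulr_natl -lnXn ?ltr0n // -natrX ler_ln ?posrE ?ltr0n ?fact_gt0 ?expn_gt0 ?n0 //.
rewrite ler_nat.
exact: fact_le_expn.
Qed.

Lemma logn_fact_ge p n : prime p -> (n%:R / p%:R - 1 : R) <= (logn p n`!)%:R.
Proof.
move=> pp; have p0 : (0 : R) < p%:R by rewrite ltr0n prime_gt0.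
have [->|n0] := posnP n; first by rewrite mul0r fact0 logn1; lra.
rewrite lerBlDr natr1 ler_pdivrMr // -natrM ler_nat.
rewrite logn_fact // big_ltn // expn1.
apply: leq_trans (ltnW (ltn_ceil n (prime_gt0 pp))) _.
by rewrite leq_mul2r ltnS leq_addr orbT.
Qed.

Lemma logn_fact_le p n : prime p -> (logn p n`!)%:R <= (n%:R / (p%:R - 1) : R).
Proof.
move=> pp; have p1 : (1 : R) < p%:R by rewrite ltr1n prime_gt1.
rewrite logn_fact // natr_sum.
apply: (@le_trans _ _ (n%:R * \sum_(1 <= k < n.+1) (p%:R ^- k))).
  rewrite mulr_sumr; apply: ler_sum => k _.
  rewrite ler_pdivlMr; last by rewrite exprn_gt0 //; lra.
  by rewrite -natrX -natrM ler_nat leq_trunc_div.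
rewrite ler_wpM2l //.
suff -> : (\sum_(1 <= k < n.+1) (p%:R ^- k) : R) = (1 - p%:R ^- n) / (p%:R - 1).
  rewrite ler_pdivrMr; last lra.
  rewrite mulVf; last by apply/eqP; lra.
  by rewrite gerBl invr_ge0 exprn_ge0 //; lra.
elim: n => [|n IH]; first by rewrite big_geq // expr0 invr1 subrr mul0r.
rewrite big_nat_recr //= IH exprS; field.
by rewrite expf_neq0; try (apply/andP; split); try apply/eqP; lra.
Qed.

(** Telescoping: 1/sqrt(m-1) - 1/sqrt m is at least 1/(2 m sqrt m). *)
Lemma sum_inv32 n : (0 < n)%N ->
  \sum_(2 <= m < n.+1) ((m%:R : R) * Num.sqrt m%:R)^-1 <= 2 - 2 / Num.sqrt n%:R.
Proof.
elim: n => // n IH _.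
have [->|n0] := posnP n; first by rewrite big_geq // sqrtr1; lra.
rewrite big_nat_recr //=.
have := IH n0; set a := Num.sqrt n%:R; set b := Num.sqrt n.+1%:R.
have a0 : 0 < a by rewrite sqrtr_gt0 ltr0n.
have b0 : 0 < b by rewrite sqrtr_gt0 ltr0n.
have a2 : a ^+ 2 = n%:R by rewrite sqr_sqrtr.
have b2 : b ^+ 2 = n.+1%:R by rewrite sqr_sqrtr.
have ab : b ^+ 2 = a ^+ 2 + 1 by rewrite a2 b2 natr1.
have lab : a <= b by rewrite ler_sqrt // ler_nat.
rewrite -b2 => h.
suff : (b ^+ 2 * b)^-1 <= 2 / a - 2 / b by lra.
have -> : 2 / a - 2 / b = 2 / (a * b * (a + b)).
  have : (b - a) * (a + b) = 1 by lra.
  move=> e; rewrite -[2 in RHS]mulr1 -e; field.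
  by apply/and3P; split; apply/eqP; lra.
rewrite ler_pdivlMr ?mulr_gt0 ?addr_gt0 // mulrC ler_pdivrMr ?mulr_gt0 ?exprn_gt0 //.
nra.
Qed.

Lemma sum_inv32_le2 n : \sum_(2 <= m < n.+1) ((m%:R : R) * Num.sqrt m%:R)^-1 <= 2.
Proof.
have [->|n0] := posnP n; first by rewrite big_geq.
by apply: le_trans (sum_inv32 n0) _; rewrite gerBl divr_ge0 // sqrtr_ge0.
Qed.

Lemma ln_le_2sqrt n : ln (n%:R : R) <= 2 * Num.sqrt n%:R.
Proof.
have [->|n0] := posnP n; first by rewrite ln0 // mulr_ge0 // sqrtr_ge0.
have s0 : (0 : R) < Num.sqrt n%:R by rewrite sqrtr_gt0 ltr0n.
rewrite -[in X in X <= _](@sqr_sqrtr _ n%:R) // lnXn //.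
have := ln_le_subr1 s0; lra.
Qed.

Lemma inv_subr1_split x y : 1 < x -> (x - 1)^-1 * y = y / x + y / (x * (x - 1)).
Proof. by move=> x1; field; apply/andP; split; apply/eqP; lra. Qed.

Definition mertens_sum n : R := \sum_(0 <= p < n.+1 | prime p) ln p%:R / p%:R.

Lemma big_prime_from2 n (F : nat -> R) :
  \sum_(0 <= p < n.+1 | prime p) F p = \sum_(2 <= p < n.+1 | prime p) F p.
Proof.
case: n => [|n]; first by rewrite big_mkcond big_nat1 big_geq.
by rewrite big_ltn_cond // big_ltn_cond.
Qed.

Lemma ln_nat_ge0 n : 0 <= ln (n%:R : R).
Proof. by case: n => [|n]; [rewrite ln0|rewrite ln_ge0 // ler1n]. Qed.

(** In ln n! = sum of logn p n! * ln p the exponent is at least n/p - 1, so n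
    times the Mertens sum exceeds ln n! by at most the Chebyshev sum of the
    ln p, which is at most n ln 4. *)
Lemma mertens_le n : (0 < n)%N -> mertens_sum n <= ln n%:R + 9.
Proof.
move=> n0; have n0' : (0 : R) < n%:R by rewrite ltr0n.
have th : \sum_(0 <= p < n.+1 | prime p) ln (p%:R : R) <= n%:R * 3.
  rewrite -(ln_prod_nat _ (F := id)); last by move=> i /prime_gt0.
  apply: (@le_trans _ _ (ln ((4 ^ n)%:R))).
    rewrite ler_ln ?posrE ?ltr0n ?expn_gt0 // ?ler_nat ?prod_primes_le //.
    by rewrite prodn_cond_gt0 // => i /prime_gt0.
  rewrite natrX lnXn // -[_ *+ n]mulr_natl ler_wpM2l //.
  have := @ln_le_subr1 4; lra.
have : n%:R * mertens_sum n - \sum_(0 <= p < n.+1 | prime p) ln (p%:R : R) <= n%:R * ln n%:R.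
  apply: le_trans (ln_fact_le n); rewrite ln_fact mulr_sumr -sumrB.
  apply: ler_sum => p pp; rewrite mulrCA -[X in _ - X]mulr1 -mulrBr mulrC.
  by rewrite ler_wpM2r ?ln_nat_ge0 // logn_fact_ge.
move=> h; rewrite -(ler_pM2l n0'); nra.
Qed.

(** The exponent of p in n! is at most n/(p-1) = n/p + n/(p(p-1)), and the sum
    of ln p/(p(p-1)) converges because ln p <= 2 sqrt p. *)
Lemma mertens_ge n : (0 < n)%N -> ln n%:R - 9 <= mertens_sum n.
Proof.
move=> n0; have n0' : (0 : R) < n%:R by rewrite ltr0n.
have h : ln ((n`!)%:R : R) <= n%:R * (mertens_sum n + 8).
  rewrite ln_fact mulrDr {1}/mertens_sum mulr_sumr.
  have : \sum_(0 <= p < n.+1 | prime p) 4 * ((p%:R : R) * Num.sqrt p%:R)^-1 <= 8.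
    rewrite big_prime_from2 -mulr_sumr; apply: (@le_trans _ _ (4 * 2)); last lra.
    rewrite ler_wpM2l //; apply: le_trans (sum_inv32_le2 n).
    rewrite [X in X <= _]big_mkcond; apply: ler_sum => i _; case: ifP => _; first by [].
    by rewrite invr_ge0 mulr_ge0 // sqrtr_ge0.
  rewrite -(ler_pM2l n0') => h.
  apply: le_trans (lerD (lexx _) h); rewrite mulr_sumr -big_split.
  apply: ler_sum => p pp /=; have p2 : (2 : R) <= p%:R by rewrite ler_nat prime_gt1.
  apply: le_trans (ler_wpM2r (ln_nat_ge0 p) (logn_fact_le n pp)) _.
  rewrite -mulrDr -mulrA ler_wpM2l //.
  have := ln_le_2sqrt p; set s := Num.sqrt _ => lnp.
  have s2 : s ^+ 2 = p%:R by rewrite sqr_sqrtr.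
  have s0 : 0 < s by rewrite sqrtr_gt0; lra.
  have l0 := ln_nat_ge0 p.
  have -> : (p%:R - 1)^-1 * ln (p%:R : R) = ln p%:R / p%:R + ln p%:R / (p%:R * (p%:R - 1)).
    by rewrite inv_subr1_split //; lra.
  rewrite lerD2l ler_pdivrMr; last by apply: mulr_gt0; lra.
  rewrite -s2 in p2 *.
  have -> : 4 * (s ^+ 2 * s)^-1 * (s ^+ 2 * (s ^+ 2 - 1)) = 4 * (s^+2 - 1) / s.
    by field; rewrite gt_eqF.
  rewrite ler_pdivlMr //.
  have : ln (s ^+ 2) * s <= 2 * s * s by apply: ler_wpM2r; [exact: ltW | rewrite s2].
  nra.
have := le_trans (ln_fact_ge n) h => h2.
rewrite -(ler_pM2l n0'); nra.
Qed.
End Mertens.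

(** * Prime sums over intervals *)

Section PrimeSums.
Variable R : realType.
Implicit Types (a b c x y z : R) (n p : nat).

Definition prime_sum a b (F : nat -> R) : R :=
  \sum_((Num.truncn a).+1 <= q < (Num.truncn b).+1 | prime q) F q.

Lemma mem_prime_range a b q : 0 <= a -> 0 <= b ->
  (q \in index_iota (Num.truncn a).+1 (Num.truncn b).+1) = (a < q%:R) && (q%:R <= b).
Proof.
by move=> a0 b0; rewrite mem_index_iota ltnS (truncn_lt_nat _ a0) (truncn_ge_nat _ b0).
Qed.

Lemma prime_sum_split a b c F : a <= b -> b <= c -> prime_sum a c F = prime_sum a b F + prime_sum b c F.
Proof.
by move=> ab bc; rewrite /prime_sum -big_cat_nat //= ltnS; apply: le_truncn.
Qed.

Lemma prime_sum_le a b F G : 0 <= a -> 0 <= b ->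
  (forall q, prime q -> a < q%:R -> q%:R <= b -> F q <= G q) ->
  prime_sum a b F <= prime_sum a b G.
Proof.
move=> a0 b0 H; rewrite /prime_sum big_seq_cond [leRHS]big_seq_cond; apply: ler_sum => q.
by rewrite mem_prime_range // => /andP[/andP[aq qb] pq]; apply: H.
Qed.

Lemma prime_sum_mull a b F x : prime_sum a b (fun q => x * F q) = x * prime_sum a b F.
Proof. by rewrite /prime_sum mulr_sumr. Qed.

Lemma ln_truncn x : 1 <= x -> ln x - 1 <= ln ((Num.truncn x)%:R : R) <= ln x.
Proof.
move=> x1; have t1 : (0 < Num.truncn x)%N by rewrite truncn_gt0.
have t1' : (0 : R) < (Num.truncn x)%:R by rewrite ltr0n.
have t2 : (1 : R) <= (Num.truncn x)%:R by rewrite ler1n.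
have x0 : 0 < x by lra.
have /andP[h1 h2] := truncn_itv (ltW x0).
rewrite ler_ln ?posrE // h1 andbT lerBlDr.
have -> : ln (Num.truncn x)%:R + 1 = ln (expR 1 * (Num.truncn x)%:R) :> R.
  by rewrite lnM ?posrE ?expR_gt0 // expRK addrC.
rewrite ler_ln ?posrE ?mulr_gt0 ?expR_gt0 //.
have := expR_ge1Dx (1 : R); rewrite -natr1 in h2; nra.
Qed.

(** The error does not grow with the interval, so on an interval whose
    logarithmic length is much larger than 20 the sum is known up to a small
    relative error. No finer information on the distribution of primes enters. *)
Lemma prime_sum_mertens a b : 1 <= a -> a <= b ->
  ln b - ln a - 20 <= prime_sum a b (fun q => ln (q%:R) / q%:R) <= ln b - ln a + 20.
Proof.
move=> a1 ab; have b1 : 1 <= b by apply: le_trans ab.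
have -> : prime_sum a b (fun q => ln (q%:R) / q%:R) =
    mertens_sum R (Num.truncn b) - mertens_sum R (Num.truncn a).
  rewrite /mertens_sum /prime_sum [in RHS](@big_cat_nat _ _ _ (Num.truncn a).+1) //=.
    by rewrite [RHS]addrC addKr.
  by rewrite ltnS le_truncn.
have /andP[? ?] := ln_truncn a1; have /andP[? ?] := ln_truncn b1.
have ta : (0 < Num.truncn a)%N by rewrite truncn_gt0.
have tb : (0 < Num.truncn b)%N by rewrite truncn_gt0.
have := mertens_le R ta; have := mertens_ge R ta.
have := mertens_le R tb; have := mertens_ge R tb.
move=> *; apply/andP; split; lra.
Qed.

Lemma harmonic_le n : \sum_(1 <= m < n.+1) (m%:R : R)^-1 <= 1 + ln n%:R.
Proof.
elim: n => [|n IH]; first by rewrite big_geq // ln0 //; lra.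
have [->|n0] := posnP n; first by rewrite big_nat1 invr1 ln1; lra.
rewrite big_nat_recr //=; apply: le_trans (lerD IH (lexx _)) _.
have n0' : (0 : R) < n%:R by rewrite ltr0n.
have : ln (n%:R / n.+1%:R : R) <= n%:R / n.+1%:R - 1.
  by apply: ln_le_subr1; rewrite divr_gt0.
rewrite ln_div ?posrE //.
have -> : (n%:R / n.+1%:R : R) = 1 - n.+1%:R^-1.
  by rewrite -[n.+1%:R]natr1; field; rewrite gt_eqF // addr_gt0.
by move: (n.+1%:R^-1) (ln n.+1%:R) => i l; lra.
Qed.

(** The sum over all integers is bounded instead; this crude bound is used only
    for the primes of the lowest block, whose contribution is negligible. *)
Lemma prime_sum_inv_le z : 1 <= z -> prime_sum 0 z (fun q => q%:R^-1) <= 1 + ln z.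
Proof.
move=> z1; have /andP[_ h] := ln_truncn z1.
apply: le_trans (lerD (lexx 1) h); apply: le_trans (harmonic_le _).
rewrite /prime_sum truncn0 big_mkcond; apply: ler_sum => i _.
by case: ifP => _ //; rewrite invr_ge0.
Qed.

(** Blocks of equal length w on the logarithmic scale. *)
Lemma prime_sum_blocks (w : R) (F : nat -> R) (J : nat) : 0 <= w -> (0 < J)%N ->
  prime_sum 0 (expR (w * J%:R)) F =
  prime_sum 0 (expR w) F + \sum_(1 <= j < J) prime_sum (expR (w * j%:R)) (expR (w * j.+1%:R)) F.
Proof.
move=> w0; elim: J => // J IH _.
have [->|J0] := posnP J; first by rewrite mulr1 big_geq // addr0.
rewrite big_nat_recr //= addrA -IH // -prime_sum_split ?expR_ge0 //.
by rewrite ler_expR ler_wpM2l // ler_nat.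
Qed.
End PrimeSums.

(** * Exponential sums *)

Section GeometricSums.
Variable R : realType.
Implicit Types (a b c x y z t th r : R) (n p i J : nat).

(** A single term of the exponential series already beats t^k. *)
Lemma near_powX_le_expR (k : nat) (c : R) : 0 < c ->
  \forall t \near +oo, t ^+ k <= expR (c * t).
Proof.
move=> c0; near=> t.
have t0 : 0 < t by near: t; apply: nbhs_pinfty_gt.
have f0 : (0 : R) < (k.+1)`!%:R by rewrite ltr0n fact_gt0.
have tk : (k.+1)`!%:R / c ^+ k.+1 <= t by near: t; apply: nbhs_pinfty_ge; exact: num_real.
have := @expR_ge1Dxn R (c * t) k (ltW (mulr_gt0 c0 t0)).
move=> h; apply: le_trans h; apply: (@le_trans _ _ ((c * t) ^+ k.+1 / k.+1`!%:R)); last by rewrite lerDr.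
rewrite ler_pdivrMr ?exprn_gt0 // in tk.
rewrite ler_pdivlMr // exprMn [t ^+ k.+1]exprSr mulrCA; apply: ler_wpM2l.
  by rewrite exprn_ge0 // ltW.
by rewrite mulrC.
Unshelve. all: by end_near. Qed.

Lemma geo0 r n : (1 - r) * \sum_(0 <= i < n) r ^+ i = 1 - r ^+ n.
Proof.
elim: n => [|n IH]; first by rewrite big_geq // mulr0 expr0 subrr.
by rewrite big_nat_recr //= mulrDr IH exprS; ring.
Qed.

Lemma geo1 r n : (1 - r) * \sum_(0 <= i < n) i.+1%:R * r ^+ i =
  \sum_(0 <= i < n) r ^+ i - n%:R * r ^+ n.
Proof.
elim: n => [|n IH]; first by rewrite !big_geq // mulr0 mul0r subrr.
by rewrite !big_nat_recr //= mulrDr IH exprS -[n.+1%:R]natr1; ring.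
Qed.

Lemma geo2 r n : (1 - r) * \sum_(0 <= i < n) (i.+1%:R * i.+2%:R) * r ^+ i =
  2 * \sum_(0 <= i < n) i.+1%:R * r ^+ i - (n%:R * n.+1%:R) * r ^+ n.
Proof.
elim: n => [|n IH]; first by rewrite !big_geq // !(mulr0,mul0r) subrr.
rewrite !big_nat_recr //; move: IH (@natr1 R n) (@natr1 R n.+1); move: (n.+2%:R : R) => b IH e1 e2.
move: e2 => /= e2; move: e2; rewrite mulrDr IH exprS -e1 => <-; ring.
Qed.

Section Geo.
Variable th : R.
Hypothesis th0 : 0 < th.
Let r := expR (- th).

Lemma geo_ratio : [/\ 0 < r, r < 1, 1 - r <= th & th <= (1 - r) * (1 + th)].
Proof.
have r0 : 0 < r by exact: expR_gt0.
have h1 := expR_ge1Dx (- th); have h2 := expR_ge1Dx th.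
have e : r * expR th = 1 by rewrite mulrC /r expRxMexpNx_1.
have r1 : r < 1 by rewrite /r expR_lt1 oppr_lt0.
have rth : r * (1 + th) <= 1 by rewrite -[leRHS]e ler_wpM2l // (ltW r0).
by rewrite -/r in h1; move: r r0 e h1 r1 rth => r' *; split; lra.
Qed.

Lemma geo_ratioX i : r ^+ i = expR (- (th * i%:R)).
Proof. by rewrite /r -expRM_natr mulNr. Qed.

Let q := 1 / th + 1.

Let inv_ratio : (1 - r) * q >= 1.
Proof.
have [r0 r1 _ h] := geo_ratio.
have -> : (1 - r) * q = (1 - r) * (1 + th) / th by rewrite /q; field; rewrite gt_eqF.
by rewrite ler_pdivlMr // mul1r.
Qed.

Lemma geo0_le n : \sum_(0 <= i < n) r ^+ i <= q.
Proof.
have [r0 r1 _ _] := geo_ratio.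
rewrite -(@ler_pM2l _ (1 - r)) ?subr_gt0 // geo0; apply: le_trans inv_ratio.
by rewrite gerBl exprn_ge0 // ltW.
Qed.

Lemma geo1_le n : \sum_(0 <= i < n) i.+1%:R * r ^+ i <= q ^+ 2.
Proof.
have [r0 r1 _ _] := geo_ratio; have := geo0_le n; have := geo1 r n.
have := inv_ratio; have : 0 <= n%:R * r ^+ n by rewrite mulr_ge0 // exprn_ge0 // ltW.
have q0 : 0 < q by rewrite addr_gt0 // divr_gt0.
move: (\sum_(0 <= i < n) r ^+ i) (n%:R * _) (\sum_(0 <= i < n) _) => A B S h1 h2 h3 h4.
rewrite -(@ler_pM2l _ (1 - r)) ?subr_gt0 // h3; nra.
Qed.

Lemma geo2_le n : \sum_(0 <= i < n) (i.+1%:R * i.+2%:R) * r ^+ i <= 2 * q ^+ 3.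
Proof.
have [r0 r1 _ _] := geo_ratio; have := geo1_le n; have := geo2 r n.
have := inv_ratio; have : 0 <= (n%:R * n.+1%:R) * r ^+ n.
  by rewrite !mulr_ge0 // exprn_ge0 // ltW.
have q0 : 0 < q by rewrite addr_gt0 // divr_gt0.
move: (\sum_(0 <= i < n) i.+1%:R * r ^+ i) (_ * _ * r ^+ n) (\sum_(0 <= i < n) _) => A B S h1 h2 h3 h4.
rewrite -(@ler_pM2l _ (1 - r)) ?subr_gt0 // h3.
have : q ^+ 2 <= (1 - r) * q * q ^+ 2 by rewrite ler_peMl // exprn_ge0 // ltW.
have -> : (1 - r) * (2 * q ^+ 3) = 2 * ((1 - r) * q * q ^+ 2) by ring.
lra.
Qed.

Lemma geo0_ge n : (1 - r ^+ n) / th <= \sum_(0 <= i < n) r ^+ i.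
Proof.
have [r0 r1 h _] := geo_ratio; rewrite ler_pdivrMr // -geo0 mulrC ler_wpM2l //.
by apply: sumr_ge0 => i _; rewrite exprn_ge0 // ltW.
Qed.

Lemma geo1_ge n : ((1 - r ^+ n) / th - 1 - n%:R * r ^+ n) / th
   <= \sum_(0 <= i < n) i%:R * r ^+ i.
Proof.
have [r0 r1 h _] := geo_ratio; rewrite ler_pdivrMr //.
have := geo0_ge n; have h0 := geo0 r n; have := geo1 r n.
have -> : \sum_(0 <= i < n) i.+1%:R * r ^+ i =
   \sum_(0 <= i < n) i%:R * r ^+ i + \sum_(0 <= i < n) r ^+ i.
  by rewrite -big_split; apply: eq_bigr => i _ /=; rewrite -natr1 mulrDl mul1r.
have : 0 <= \sum_(0 <= i < n) i%:R * r ^+ i.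
  by apply: sumr_ge0 => i _; rewrite mulr_ge0 // exprn_ge0 // ltW.
have rn : 0 <= r ^+ n by rewrite exprn_ge0 // ltW.
set A := \sum_(0 <= i < n) r ^+ i in h0 *; set S := \sum_(0 <= i < n) _.
move=> S0 h1 h2; have h3 : (1 - r) * S <= th * S by rewrite ler_wpM2r.
lra.
Qed.

Lemma sum_rev J (F : nat -> R) :
  \sum_(1 <= j < J.+1) F j = \sum_(0 <= i < J) F (J - i)%N.
Proof.
rewrite big_add1 /= big_nat_rev /=; apply: eq_big_nat => i /andP[_ iJ].
by congr F; lia.
Qed.

Lemma expR_sub_geo J i : (i <= J)%N ->
  expR (th * (J - i)%:R) = expR (th * J%:R) * r ^+ i.
Proof. by move=> iJ; rewrite geo_ratioX -expRD natrB //; congr expR; ring. Qed.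

(** The sum is a Riemann sum for the integral of exp s / s up to t = th J. It is
    dominated by the j close to J: with j = J - i, the weight is exp t * r^i with
    r = exp (- th), and expanding 1/(J-i) in powers of i/J reduces everything to
    geometric sums. When J is much larger than a power of t, kap is close to 1/t
    and the bound reads exp t (1/t + 1/t^2 + O(1/t^3)). *)
Lemma exp_sum_le J kap : (0 < J)%N -> kap = (th * J%:R)^-1 + J%:R^-1 ->
  \sum_(1 <= j < J.+1) expR (th * j%:R) / j%:R <=
  expR (th * J%:R) * (kap + kap ^+ 2 + 4 * kap ^+ 3 + J%:R * expR (- (th * J%:R / 2))).
Proof.
move=> J0 kapE; rewrite sum_rev.
have J0' : (0 : R) < J%:R by rewrite ltr0n.
have [r0 r1 _ _] := geo_ratio.
have kq : kap = q / J%:R by rewrite kapE /q; field; rewrite !gt_eqF.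
set D := expR (- _).
apply: (@le_trans _ _ (expR (th * J%:R) * \sum_(0 <= i < J)
   ((r ^+ i / J%:R + (i.+1%:R * r ^+ i) / J%:R ^+ 2 +
     2 * (i.+1%:R * i.+2%:R * r ^+ i) / J%:R ^+ 3) + D))).
  rewrite mulr_sumr; apply: ler_sum_nat => i /andP[_ iJ].
  rewrite expR_sub_geo 1?ltnW // -mulrA ler_wpM2l ?expR_ge0 // natrB 1?ltnW //.
  have ri : 0 <= r ^+ i by rewrite exprn_ge0 // ltW.
  have i0 : (0 : R) <= i%:R by [].
  have iJ1 : (i%:R + 1 <= J%:R :> R) by rewrite natr1 ler_nat.
  (* 1/(J-i) = 1/J + i/J^2 + i^2/(J^2 (J-i)); the last term is at most 2 i^2/J^3
     for 2 i <= J, and for the other i the weight r^i is at most D. *)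
  have [h|h] := leP (i%:R * 2 : R) J%:R.
    rewrite -[leLHS]addr0 lerD ?expR_ge0 //.
    have -> : r ^+ i / J%:R + i.+1%:R * r ^+ i / J%:R ^+ 2 +
        2 * (i.+1%:R * i.+2%:R * r ^+ i) / J%:R ^+ 3 =
        r ^+ i * (J%:R^-1 + i.+1%:R / J%:R ^+ 2 + 2 * (i.+1%:R * i.+2%:R) / J%:R ^+ 3).
      by field; rewrite gt_eqF.
    rewrite ler_wpM2l // -[i.+2%:R]natr1 -[i.+1%:R]natr1.
    move: (i%:R) (J%:R : R) i0 iJ1 h J0' => a b a0 ab h b0.
    have -> : b^-1 + (a + 1) / b ^+ 2 + 2 * ((a + 1) * (a + 1 + 1)) / b ^+ 3 =
       (b ^+ 2 + (a + 1) * b + 2 * ((a + 1) * (a + 1 + 1))) / b ^+ 3.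
      by field; rewrite gt_eqF.
    rewrite ler_pdivlMr ?exprn_gt0 // mulrC ler_pdivrMr; last lra.
    have -> : (b ^+ 2 + (a + 1) * b + 2 * ((a + 1) * (a + 1 + 1))) * (b - a)
      = b ^+ 3 + b * (b - a) + (2 * (a+1) * (a + 2) * (b - a) - a ^+ 2 * b) by ring.
    nra.
  have rD : r ^+ i <= D.
    by rewrite geo_ratioX ler_expR lerN2 ler_pdivrMr // -mulrA ler_wpM2l // ltW.
  rewrite -[leLHS]add0r lerD //.
    by rewrite !addr_ge0 // divr_ge0 // ?exprn_ge0 // !mulr_ge0.
  apply: le_trans rD; rewrite ler_piMr // invf_le1; lra.
rewrite ler_wpM2l ?expR_ge0 // 3!big_split /= -!mulr_suml -mulr_sumr.
rewrite sumr_const_nat subn0 -[D *+ J]mulr_natl lerD2r.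
have -> : 4 * kap ^+ 3 = 2 * (2 * q ^+ 3) / J%:R ^+ 3 by rewrite kq; field; rewrite gt_eqF.
have -> : kap ^+ 2 = q ^+ 2 / J%:R ^+ 2 by rewrite kq; field; rewrite gt_eqF.
rewrite {1}kq !lerD // ler_wpM2r ?invr_ge0 ?exprn_ge0 //; first exact: geo0_le.
  exact: geo1_le.
by rewrite ler_wpM2l // geo2_le.
Qed.

(** The matching lower bound: only the n largest indices are kept, and
    1/(J-i) >= 1/J + i/J^2. *)
Lemma exp_sum_ge J n t : (0 < J)%N -> (n <= J)%N -> t = th * J%:R ->
  expR t * ((1 - r ^+ n) / t + ((1 - r ^+ n) / t - J%:R^-1 - r ^+ n) / t) <=
  \sum_(0 <= i < n) expR (th * (J - i)%:R) / (J - i)%:R.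
Proof.
move=> J0 nJ tE.
have J0' : (0 : R) < J%:R by rewrite ltr0n.
have [r0 r1 _ _] := geo_ratio.
have rn i : 0 <= r ^+ i by rewrite exprn_ge0 // ltW.
apply: (@le_trans _ _ (expR t * \sum_(0 <= i < n) (r ^+ i / J%:R + i%:R * r ^+ i / J%:R ^+ 2))).
  rewrite ler_wpM2l ?expR_ge0 // big_split /= -!mulr_suml lerD //.
    apply: le_trans (ler_wpM2r _ (geo0_ge n)); last by rewrite invr_ge0.
    by rewrite le_eqVlt; apply/orP; left; apply/eqP; rewrite tE; field; rewrite !gt_eqF.
  apply: le_trans (ler_wpM2r _ (geo1_ge n)); last by rewrite invr_ge0 exprn_ge0.
  have -> : ((1 - r ^+ n) / th - 1 - n%:R * r ^+ n) / th / J%:R ^+ 2 =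
      ((1 - r ^+ n) / t - J%:R^-1 - (n%:R / J%:R) * r ^+ n) / t.
    by rewrite tE; field; rewrite !gt_eqF.
  rewrite tE ler_wpM2r ?invr_ge0 ?mulr_ge0 // ?(ltW th0) // lerD2l lerN2 ler_piMl //.
  by rewrite ler_pdivrMr // mul1r ler_nat.
rewrite mulr_sumr; apply: ler_sum_nat => i /andP[_ iJ].
have iJ' : (i <= J)%N by lia.
rewrite expR_sub_geo // -tE -[leRHS]mulrA ler_wpM2l ?expR_ge0 // natrB //.
have -> : r ^+ i / J%:R + i%:R * r ^+ i / J%:R ^+ 2 = r ^+ i * ((J%:R + i%:R) / J%:R ^+ 2).
  by field; rewrite gt_eqF.
have ij : (0 : R) < J%:R - i%:R by rewrite subr_gt0 ltr_nat; lia.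
rewrite ler_wpM2l // -[leRHS]mul1r ler_pdivlMr // mulrAC ler_pdivrMr ?exprn_gt0 //.
have : 0 <= (i%:R : R) ^+ 2 by rewrite exprn_ge0.
lra.
Qed.
End Geo.
End GeometricSums.

(** * The tilted prime sum *)

Section TiltedPrimeSum.
Variable R : realType.
Implicit Types (a b c x y z t th r : R) (n p i J : nat).

(** One threshold for all the numerical comparisons below. The power is compared
    with exp (t/8) rather than exp t because the neglected tails of the geometric
    sums are only of order exp (- t/2). *)
Definition large t := 100 <= t /\ t ^+ 20 <= expR (t / 8).

Lemma near_large : \forall t \near +oo, large t.
Proof.
near=> t; split; first by near: t; apply: nbhs_pinfty_ge; exact: num_real.
rewrite [t / 8]mulrC; near: t; apply: near_powX_le_expR; lra.
Unshelve. all: by end_near. Qed.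

(** The weight n^(- sg) of Rankin's method. *)
Definition powN (sg : R) n : R := expR (- (sg * ln (n%:R : R))).

Lemma powN_gt0 sg n : 0 < powN sg n. Proof. exact: expR_gt0. Qed.

Lemma powNM sg m n : (0 < m)%N -> (0 < n)%N -> powN sg (m * n) = powN sg m * powN sg n.
Proof.
by move=> m0 n0; rewrite /powN natrM lnM ?posrE ?ltr0n // mulrDr opprD expRD.
Qed.

(** For sg = 1 - t/v and q = exp (v l) the weight is exp (t l)/q: it only depends
    on the position l of ln q relative to v. *)
Lemma powN_tilt t v q : (0 < q)%N -> powN (1 - t / v) q = q%:R^-1 * expR (t / v * ln q%:R).
Proof.
move=> q0; rewrite /powN mulrBl mul1r opprB expRB lnK ?posrE ?ltr0n //.
by rewrite mulrC.
Qed.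

(** On the block the factor exp (t ln q / v)/ln q varies little, and what remains
    is a Mertens sum. *)
Lemma tilted_block_le t v (J j : nat) : 0 < t -> 0 < v -> (0 < J)%N -> (0 < j)%N ->
  prime_sum (expR (v / J%:R * j%:R)) (expR (v / J%:R * j.+1%:R)) (powN (1 - t / v)) <=
  (1 + 20 * J%:R / v) * (expR (t / J%:R * j.+1%:R) / j%:R).
Proof.
move=> t0 v0 J0 j0; have J0' : (0 : R) < J%:R by rewrite ltr0n.
have j0' : (0 : R) < j%:R by rewrite ltr0n.
set w := v / J%:R; have w0 : 0 < w by rewrite divr_gt0.
set B := expR (t / _ * _).
apply: (@le_trans _ _ ((B / (w * j%:R)) * prime_sum (expR (w * j%:R)) (expR (w * j.+1%:R)) (fun q => ln (q%:R) / q%:R))).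
  rewrite -prime_sum_mull; apply: prime_sum_le; rewrite ?expR_ge0 // => q pq.
  have q0 : (0 < q)%N by apply: prime_gt0.
  have q0' : (0 : R) < q%:R by rewrite ltr0n.
  rewrite -[X in _ < X]lnK ?posrE // -[X in X <= _]lnK ?posrE // ltr_expR ler_expR => lq1 lq2.
  rewrite powN_tilt // mulrA [leRHS]mulrC ler_wpM2l ?invr_ge0 ?ler0n //.
  have lq0 : 0 < ln (q%:R : R) by apply: lt_trans lq1; rewrite mulr_gt0.
  apply: (@le_trans _ _ B).
    rewrite ler_expR; apply: (@le_trans _ _ (t / v * (w * j.+1%:R))).
      by rewrite ler_wpM2l // divr_ge0 ?ltW.
    rewrite le_eqVlt; apply/orP; left; apply/eqP.
    by rewrite /w; field; rewrite !gt_eqF.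
  rewrite mulrAC ler_pdivlMr ?(mulr_gt0 w0 j0') //.
  by rewrite ler_wpM2l ?expR_ge0 // ltW.
have h1 : 1 <= expR (w * j%:R) by rewrite -[1]expR0 ler_expR mulr_ge0 // ltW.
have h2 : expR (w * j%:R) <= expR (w * j.+1%:R) by rewrite ler_expR ler_wpM2l ?ltW // ltr_nat.
have /andP[_] := prime_sum_mertens h1 h2; rewrite !expRK => h3.
have c0 : 0 <= B / (w * j%:R) by rewrite divr_ge0 ?expR_ge0 // mulr_ge0 // ltW.
apply: le_trans (ler_wpM2l c0 h3) _; rewrite -[j.+1%:R]natr1 le_eqVlt; apply/orP; left; apply/eqP.
by rewrite /w; field; rewrite !gt_eqF.
Qed.

Lemma tilted_sum_le_exp_sum t v (J : nat) : 0 < t -> 0 < v -> (0 < J)%N ->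
  prime_sum 0 (expR v) (powN (1 - t / v)) <=
  expR (t / J%:R) * (1 + v / J%:R + (1 + 20 * J%:R / v) *
     \sum_(1 <= j < J.+1) expR (t / J%:R * j%:R) / j%:R).
Proof.
move=> t0 v0 J0; have J0' : (0 : R) < J%:R by rewrite ltr0n.
have -> : expR v = expR (v / J%:R * J%:R) by rewrite divfK // gt_eqF.
have w0 : 0 < v / J%:R by rewrite divr_gt0.
rewrite prime_sum_blocks ?(ltW w0) // mulrDr lerD //.
  apply: (@le_trans _ _ (expR (t / J%:R) * prime_sum 0 (expR (v / J%:R)) (fun q => q%:R^-1))).
    rewrite -prime_sum_mull; apply: prime_sum_le; rewrite ?expR_ge0 // => q pq _ qv.
    have q0 : (0 < q)%N by apply: prime_gt0.
    have q0' : (0 : R) < q%:R by rewrite ltr0n.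
    rewrite powN_tilt // mulrC ler_wpM2r ?invr_ge0 ?ler0n // ler_expR.
    have -> : t / J%:R = t / v * (v / J%:R) by field; rewrite !gt_eqF.
    apply: ler_wpM2l; first by rewrite divr_ge0 // ltW.
    by rewrite -ler_expR lnK ?posrE.
  rewrite ler_wpM2l ?expR_ge0 //; have z1 : 1 <= expR (v / J%:R).
    rewrite -[X in X <= _]expR0 ler_expR. exact: (ltW w0).
  by have := prime_sum_inv_le z1; rewrite expRK.
rewrite mulrCA mulr_sumr mulr_sumr big_nat_recr //=.
apply: (@le_trans _ _ (\sum_(1 <= j < J) (1 + 20 * J%:R / v) * (expR (t / J%:R) * (expR (t / J%:R * j%:R) / j%:R)))); last first.
  rewrite lerDl !mulr_ge0 ?expR_ge0 ?invr_ge0 //.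
  by rewrite addr_ge0 // divr_ge0 ?mulr_ge0 // ltW.
apply: ler_sum_nat => j /andP[j0 _]; apply: le_trans (tilted_block_le t0 v0 J0 j0) _.
by rewrite mulrA -expRD -[j.+1%:R]natr1 mulrDr mulr1 [X in expR X]addrC.
Qed.
End TiltedPrimeSum.

Section LargeParameter.
Variable R : realType.
Implicit Types (a b c x y z t th r : R) (n p i J : nat).

Lemma large_expR t : large t -> t ^+ 20 <= expR t.
Proof.
move=> [t1 h]; apply: le_trans h _; rewrite ler_expR; lra.
Qed.

Lemma exprS_le t (m n : nat) : 100 <= t -> (m <= n)%N -> 100 ^+ (n - m) * t ^+ m <= t ^+ n.
Proof.
move=> t1 mn; rewrite -[in leRHS](subnK mn) exprD ler_wpM2r ?exprn_ge0 //; first lra.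
by rewrite lerXn2r // nnegrE; lra.
Qed.

Lemma expR_le_1D2 x : 0 <= x -> x <= 1 / 2 -> expR x <= 1 + 2 * x.
Proof.
move=> x0 x1; have := expR_ge1Dx (- x); rewrite expRN => h.
have e0 := expR_gt0 x.
have : (1 - x) * expR x <= 1 by rewrite -ler_pdivlMr // div1r.
nra.
Qed.

(** The comparisons that let lower order terms be absorbed. *)
Lemma small_powers (w : R) : 0 < w -> w <= 1 / 100 ->
  [/\ 0 < w ^+ 2 /\ w ^+ 2 <= w / 100, 0 < w ^+ 3 /\ w ^+ 3 <= w ^+ 2 / 100,
   0 < w ^+ 4 /\ w ^+ 4 <= w ^+ 3 / 100 & 0 < w ^+ 5 /\ w ^+ 5 <= w ^+ 4 / 100].
Proof.
move=> w0 w1; have W0 (m : nat) : 0 < w ^+ m by rewrite exprn_gt0.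
have W (m : nat) : w ^+ m.+1 <= w ^+ m / 100.
  by rewrite exprSr; apply: ler_wpM2l; [exact: ltW | lra].
by split; split=> //; rewrite ?W //; exact: (W 1%N).
Qed.

(** The numerical end of the next proof; w stands for 1/t, kap for 1/t + 1/J, and
    A, B, D, F for the errors of the block decomposition. *)
Lemma tilted_numerics (w kap D S E F A B : R) :
  0 < w -> w <= 1 / 100 -> 0 < E -> 1 <= E * w ^+ 5 ->
  0 <= kap -> kap <= w + w ^+ 5 -> D <= w ^+ 4 ->
  0 <= S -> S <= E * (kap + kap ^+ 2 + 4 * kap ^+ 3 + D) ->
  0 <= F -> F <= 1 + 2 * w ^+ 4 -> 0 <= A -> A <= 4 * E * w ^+ 5 ->
  0 <= B -> B <= w ^+ 4 ->
  F * (1 + A + (1 + B) * S) <= E * (w + w ^+ 2 + 40 * w ^+ 3).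
Proof.
move=> w0 w1 E0 one k0 k1 D1 S0 hS F0 F1 A0 A1 B0 B1.
have [[w20 W2] [w30 W3] [w40 W4] [w50 W5]] := small_powers w0 w1.
have k2 : kap ^+ 2 <= w ^+ 2 + w ^+ 3.
  apply: (@le_trans _ _ ((w + w ^+ 3) ^+ 2)).
    by rewrite lerXn2r ?nnegrE //; clear -k0 k1 W3 W4 W5 w0 w20 w30; lra.
  have -> : (w + w ^+ 3) ^+ 2 = w ^+ 2 + w ^+ 3 * (w * (2 + w ^+ 2)) by ring.
  rewrite lerD2l ler_piMr ?(ltW w30) //; clear -w0 w1 w20 W2; nra.
have k3 : kap ^+ 3 <= 2 * w ^+ 3.
  rewrite exprS; apply: (@le_trans _ _ ((w + w ^+ 2) * (w ^+ 2 + w ^+ 3))).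
    apply: ler_pM => //; rewrite ?exprn_ge0 //; clear -k1 W3 W4 W5 w20 w30; lra.
  have -> : (w + w ^+ 2) * (w ^+ 2 + w ^+ 3) = w ^+ 3 * (1 + 2 * w + w ^+ 2) by ring.
  by rewrite mulrC ler_wpM2r ?(ltW w30) //; clear -w1 W2; lra.
have S1 : S <= E * (w + w ^+ 2 + 11 * w ^+ 3).
  apply: le_trans hS _; rewrite ler_wpM2l ?(ltW E0) //; clear -k1 k2 k3 D1 W4 W5 w30; lra.
set T := w + w ^+ 2 + 11 * w ^+ 3 in S1 *.
have T1 : T <= 1 by rewrite /T; clear -w1 W2 W3; lra.
have T0 : 0 <= T by rewrite /T; clear -w0 w20 w30; lra.
apply: (@le_trans _ _ ((1 + 2 * w ^+ 4) * (E * (T + 6 * w ^+ 5 + w ^+ 4)))).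
  apply: ler_pM => //; first by rewrite !addr_ge0 // mulr_ge0 // addr_ge0.
  have : (1 + B) * S <= (1 + w ^+ 4) * (E * T).
    by apply: ler_pM => //; [rewrite addr_ge0 | rewrite lerD2l].
  have : E * T * w ^+ 4 <= E * w ^+ 4.
    by rewrite mulrAC ler_piMr // mulr_ge0 // ltW.
  clear -one A1; lra.
rewrite mulrCA ler_wpM2l ?(ltW E0) //.
have : w ^+ 4 * (T + 6 * w ^+ 5 + w ^+ 4) <= w ^+ 4 * 2.
  by rewrite ler_wpM2l ?(ltW w40) //; clear -T1 w1 W2 W3 W4 W5; lra.
rewrite /T; clear -W4 W5 w30; lra.
Qed.

(** The bound does not depend on v: the change of variable ln q = v l turns the
    sum into the integral of exp (t l)/l. This is what allows the upper bound to
    use the same t for every size exp v of the largest prime factor. The range of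
    v only has to keep v/J small compared with exp t, and J/v small. *)
Lemma tilted_prime_sum_le t v J : large t -> t ^+ 5 <= J%:R -> J%:R <= t ^+ 5 + 1 ->
  expR t / 4 <= v -> v <= 4 * expR t ->
  prime_sum 0 (expR v) (powN (1 - t / v)) <=
    expR t * (t^-1 + t^-1 ^+ 2 + 40 * t^-1 ^+ 3).
Proof.
move=> lt J1 J2 v1 v2.
have [t1 X1] := lt; have E1 := large_expR lt; set E := expR t in v1 v2 E1 *.
have t0 : 0 < t by lra.
have E0 : 0 < E by exact: expR_gt0.
have v0 : 0 < v by apply: lt_le_trans v1; rewrite divr_gt0.
have t50 : 0 < t ^+ 5 by rewrite exprn_gt0.
have J0' : (0 : R) < J%:R by apply: lt_le_trans J1.
have J0 : (0 < J)%N by rewrite -(ltr0n R).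
set w := t^-1; have w0 : 0 < w by rewrite invr_gt0.
have wt : w * t = 1 by rewrite mulVf // gt_eqF.
have w1 : w <= 1 / 100 by rewrite /w -[_^-1]div1r ler_pdivrMr //; lra.
have iJ : J%:R^-1 <= w ^+ 5 by rewrite /w exprVn lef_pV2 // posrE.
have th_le : t / J%:R <= w ^+ 4.
  have -> : w ^+ 4 = t * w ^+ 5 by rewrite /w; field; rewrite gt_eqF.
  by rewrite ler_wpM2l // ltW.
have th_gt : 0 < t / J%:R by rewrite divr_gt0.
have P20 (m : nat) : (m < 20)%N -> 1 <= E * w ^+ m / 100.
  move=> m20; rewrite /w exprVn ler_pdivlMr // mul1r ler_pdivlMr ?exprn_gt0 //.
  apply: le_trans E1; apply: le_trans (exprS_le t1 (ltnW m20)).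
  rewrite ler_wpM2r ?exprn_ge0 ?(ltW t0) // -[leLHS]expr1 ler_eXn2l ?subn_gt0 //; lra.
have t5E : 1 <= t ^+ 5 by rewrite exprn_ege1 //; lra.
have vJ : v / J%:R <= 4 * E * w ^+ 5.
  by apply: ler_pM => //; rewrite ?invr_ge0 ltW.
have Jv : 20 * J%:R / v <= w ^+ 4.
  rewrite ler_pdivrMr //; apply: (@le_trans _ _ (w ^+ 4 * (E / 4))); last first.
    by rewrite ler_wpM2l ?exprn_ge0 // ltW.
  have h := P20 10 isT.
  have : 40 * t ^+ 5 <= 40 * t ^+ 5 * (E * w ^+ 10 / 100).
    by rewrite ler_peMr // mulr_ge0 // ltW.
  have -> : 40 * t ^+ 5 * (E * w ^+ 10 / 100) = 4 / 10 * E * w ^+ 5.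
    by rewrite /w; field; rewrite gt_eqF.
  have : E * w ^+ 5 <= E * w ^+ 4 / 100.
    rewrite -[leRHS]mulrA [w ^+ 5]exprSr; apply: ler_wpM2l; first exact: ltW.
    by apply: ler_wpM2l; [rewrite exprn_ge0 // ltW|lra].
  have : 0 <= E * w ^+ 4 by rewrite mulr_ge0 ?exprn_ge0 // ltW.
  lra.
have Jt : J%:R * expR (- (t / J%:R * J%:R / 2)) <= w ^+ 4.
  rewrite divfK ?gt_eqF //.
  have hX : expR (- (t / 2)) <= w ^+ 20.
    rewrite expRN /w exprVn lef_pV2 ?posrE ?expR_gt0 ?exprn_gt0 //.
    apply: le_trans X1 _; rewrite ler_expR; lra.
  have : J%:R <= 2 * t ^+ 5 by lra.
  move=> hJ; apply: (@le_trans _ _ (2 * t ^+ 5 * w ^+ 20)).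
    by apply: ler_pM => //; rewrite ?expR_ge0 // ltW.
  have -> : 2 * t ^+ 5 * w ^+ 20 = w ^+ 4 * (2 * w ^+ 11).
    by rewrite /w; field; rewrite gt_eqF.
  rewrite ler_piMr ?exprn_ge0 ?(ltW w0) //.
  have : w ^+ 11 <= w by rewrite -[leRHS]expr1 ler_wiXn2l // ?ltW //; lra.
  lra.
have tJ : (t / J%:R * J%:R)^-1 = w by rewrite divfK // gt_eqF.
have := @exp_sum_le _ _ th_gt J _ J0 (erefl _); rewrite tJ.
have -> : expR (t / J%:R * J%:R) = E by rewrite divfK // gt_eqF.
move: Jt; set D := J%:R * _ => D1.
have D0 : 0 <= D by rewrite mulr_ge0 // expR_ge0.
set S := \sum_(1 <= j < _) _ => hS.
apply: le_trans (tilted_sum_le_exp_sum t0 v0 J0) _; rewrite -/S.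
have eth : expR (t / J%:R) <= 1 + 2 * w ^+ 4.
  apply: le_trans (expR_le_1D2 (ltW th_gt) _) _; last lra.
  apply: le_trans th_le _; apply: (@le_trans _ _ w); last lra.
  by rewrite -[leRHS]expr1 ler_wiXn2l ?ltW //; lra.
set kap := w + J%:R^-1 in hS.
have k1 : kap <= w + w ^+ 5 by rewrite /kap lerD2l.
have k0 : 0 <= kap by apply: addr_ge0; rewrite ?invr_ge0; exact: ltW.
have vJ0 : 0 <= v / J%:R by apply: divr_ge0; [exact: ltW | rewrite ler0n].
have Jv0 : 0 <= 20 * J%:R / v by apply: divr_ge0; [rewrite mulr_ge0 | exact: ltW].
have S0 : 0 <= S by rewrite sumr_ge0 // => j _; rewrite divr_ge0 ?expR_ge0.
have one : 1 <= E * w ^+ 5 by move: (P20 5%N isT); clear; lra.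
exact: (tilted_numerics w0 w1 E0 one k0 k1 D1 S0 hS (expR_ge0 _) eth vJ0 vJ Jv0 Jv).
Qed.
End LargeParameter.

(** * Rankin's method *)

(** The union bounds and reindexings below are all instances of this inequality,
    which avoids describing exactly which terms are hit. *)
Lemma sum_subset_le (R : realType) (T : eqType) (s s' : seq T) (F : T -> R) :
  uniq s -> {subset s <= s'} -> (forall x, 0 <= F x) ->
  \sum_(x <- s) F x <= \sum_(x <- s') F x.
Proof.
move=> us ss' F0; elim: s us s' ss' => [|x s IH] /= us s' ss'.
  by rewrite big_nil sumr_ge0.
case/andP: us => xs us; have xs' : x \in s' by apply: ss'; rewrite mem_head.
rewrite big_cons [leRHS](perm_big _ (perm_to_rem xs')) big_cons lerD2l IH // => z zs.
have zx : z != x by apply: contraNneq xs => <-.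
by rewrite rem_mem // ss' // inE zs orbT.
Qed.

Definition upto (y : nat) : nat_pred := [pred q : nat | (q <= y)%N].

Section Rankin.
Variable R : realType.
Implicit Types (a b c x y z t th r sg : R) (n p i J : nat).

Lemma upto_dvd (y m q : nat) : (upto y).-nat (q * m)%N -> (upto y).-nat m.
Proof. by move=> h; apply: pnat_dvd h; rewrite dvdn_mull. Qed.

(** Induction on y, adding one prime q at a time: the smooth integers divisible by
    q are q times smooth integers, so the sum B over y-smooth integers and the
    previous sum A satisfy B <= A + q^(- sg) B. This gives the Euler product
    without expanding geometric series. *)
Lemma smooth_sum_le sg (y M : nat) : (forall q, prime q -> powN sg q < 1) ->
  \sum_(1 <= m < M.+1 | (upto y).-nat m) powN sg m <=
  \prod_(0 <= q < y.+1 | prime q) (1 - powN sg q)^-1.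
Proof.
move=> H; have rge0 n : 0 <= powN sg n by rewrite ltW // powN_gt0.
elim: y => [|y IH].
  rewrite [leRHS]big_mkcond big_nat1 /=.
  apply: (@le_trans _ _ (\sum_(m <- [:: 1%N]) powN sg m)).
    rewrite -big_filter; apply: sum_subset_le => [||m //].
      by rewrite filter_uniq // iota_uniq.
    move=> m; rewrite mem_filter mem_index_iota inE => /and3P[sm m0 _].
    have [|m1|_ //] := ltngtP m 1; first by rewrite ltnNge m0.
    have := pdiv_prime m1; move/pnatPpi: sm => /(_ (pdiv m)).
    by rewrite pi_pdiv m1 => /(_ isT); rewrite inE /= leqn0 => /eqP ->.
  by rewrite big_seq1 /powN ln1 mulr0 oppr0 expR0.
rewrite [leRHS]big_mkcond big_nat_recr // -big_mkcond /=.
set A := \sum_(_ <= _ < _ | _) _ in IH; set B := \sum_(_ <= _ < _ | _) _.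
case: ifPn => [pq|npq]; last first.
  rewrite mulr1; suff -> : B = A by [].
  rewrite /A /B big_nat_cond [RHS]big_nat_cond; apply: eq_bigl => m.
  apply: andb_id2l => /andP[m0 _]; apply/pnatP/pnatP => // h p pp pm.
    by have := h p pp pm; rewrite !inE leq_eqVlt ltnS => /orP[/eqP e|//]; rewrite e in pp; rewrite pp in npq.
  by have := h p pp pm; rewrite !inE => /leq_trans; apply.
set q := y.+1 in pq *; have fq : 0 < 1 - powN sg q by rewrite subr_gt0 H.
rewrite ler_pdivlMr // mulrBr mulr1 lerBlDr; apply: le_trans (lerD IH (lexx _)).
(* B = (multiples of q) + (the others); the others are y-smooth. *)
rewrite {1}/B (bigID (fun m => q %| m)%N) /= addrC lerD //.
  rewrite /A [leLHS]big_nat_cond [leRHS]big_nat_cond [leLHS]big_mkcond [leRHS]big_mkcond.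
  apply: ler_sum => m _; case: ifP => [/and3P[mM sm nq]|_]; last by case: ifP.
  rewrite mM /= ifT //; case/andP: mM => m0 _; apply/pnatP => // p pp pm.
  have := pnatPpi sm; move=> /(_ p); rewrite mem_primes pp m0 pm !inE => /(_ isT).
  by rewrite leq_eqVlt ltnS => /orP[/eqP e|//]; rewrite -/q in e; rewrite e in pm; rewrite pm in nq.
rewrite mulrC /B mulr_sumr -[leLHS]big_filter -[leRHS]big_filter.
set s := [seq m <- index_iota 1 M.+1 | (upto q).-nat m].
have -> : \sum_(m <- s) powN sg q * powN sg m = \sum_(n <- map (muln q) s) powN sg n.
  rewrite big_map; apply: eq_big_seq => m; rewrite mem_filter mem_index_iota => /and3P[_ m0 _].
  by rewrite powNM.
apply: sum_subset_le => //; first by rewrite filter_uniq // iota_uniq.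
move=> n; rewrite mem_filter mem_index_iota => /and3P[/andP[sn /dvdnP[k nk]] n0 nM].
apply/mapP; exists k; last by rewrite nk mulnC.
have k0 : (0 < k)%N by move: n0; rewrite nk muln_gt0 => /andP[].
rewrite mem_filter mem_index_iota k0 (@upto_dvd _ k q) ?[(q * k)%N]mulnC -?nk //=.
by apply: leq_ltn_trans nM; rewrite nk leq_pmulr.
Qed.

(** This keeps 1/(1 - q^(- sg)) <= exp (q^(- sg) + 3 q^(- 2 sg)) for all primes; it
    amounts to 81/16 <= 8. *)
Lemma powN_prime_le sg q : 3 / 4 <= sg -> prime q -> powN sg q <= 2 / 3.
Proof.
move=> sg0 pq; have q2 : (2 : R) <= q%:R by rewrite ler_nat prime_gt1.
have l2 : ln (2 : R) <= ln q%:R by rewrite ler_ln // posrE; lra.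
have l20 : 0 <= ln (2 : R) by rewrite ln_ge0 //; lra.
have l3 : ln (3 / 2 : R) <= 3 / 4 * ln 2.
  have : ln ((3 / 2 : R) ^+ 4) <= ln (2 ^+ 3).
    by rewrite ler_ln ?posrE ?exprn_gt0 //; lra.
  rewrite !lnXn; [|lra..].
  rewrite -[_ *+ 4]mulr_natl -[_ *+ 3]mulr_natl; lra.
have -> : (2 / 3 : R) = expR (- ln (3 / 2)) by rewrite expRN lnK ?posrE; lra.
rewrite ler_expR lerN2; apply: le_trans l3 _; apply: ler_pM => //; lra.
Qed.

(** The squares q^(- 2 sg) are at most q^(- 3/2) and contribute a constant. *)
Lemma rankin_euler sg (y M : nat) : 3 / 4 <= sg ->
  \sum_(1 <= m < M.+1 | (upto y).-nat m) powN sg m <=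
  expR (\sum_(0 <= q < y.+1 | prime q) powN sg q + 6).
Proof.
move=> sg0; have f23 q : prime q -> powN sg q <= 2 / 3 by apply: powN_prime_le.
apply: le_trans (@smooth_sum_le sg y M _) _; first by move=> q /f23; lra.
apply: (@le_trans _ _ (\prod_(0 <= q < y.+1 | prime q) expR (powN sg q + 3 * powN sg q ^+ 2))).
  apply: ler_prod => q pq; have := f23 q pq; have := powN_gt0 sg q.
  move: (powN sg q) => s s0 s1; rewrite invr_ge0 subr_ge0; apply/andP; split; first lra.
  have := expR_ge1Dx (s + 3 * s ^+ 2); apply: le_trans.
  rewrite -[leLHS]div1r ler_pdivrMr; last lra.
  have -> : (1 + (s + 3 * s ^+ 2)) * (1 - s) = 1 + s ^+ 2 * (2 - 3 * s) by ring.
  by rewrite lerDl mulr_ge0 ?exprn_ge0 //; lra.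
rewrite -expR_sum ler_expR big_split /= lerD2l.
rewrite -mulr_sumr big_prime_from2.
have := sum_inv32_le2 R y.
suff : \sum_(2 <= p < y.+1 | prime p) powN sg p ^+ 2 <=
       \sum_(2 <= m < y.+1) ((m%:R : R) * Num.sqrt m%:R)^-1 by lra.
rewrite [leLHS]big_mkcond; apply: ler_sum_nat => q /andP[q2 _]; case: ifP => _; last first.
  by rewrite invr_ge0 mulr_ge0 // sqrtr_ge0.
have q1 : (1 : R) <= q%:R by rewrite ler1n; lia.
have q0 : (0 : R) < q%:R by lra.
have sq0 : 0 < Num.sqrt (q%:R : R) by rewrite sqrtr_gt0.
rewrite /powN -expRM_natr -[leRHS]lnK; last by rewrite posrE invr_gt0 mulr_gt0.
rewrite ler_expR lnV ?posrE ?mulr_gt0 // lnM ?posrE //.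
have : ln (q%:R : R) = 2 * ln (Num.sqrt q%:R).
  by rewrite -[in LHS](sqr_sqrtr (ltW q0)) lnXn // mulr_natl.
have := ln_ge0 q1; nra.
Qed.

(** Every n <= x counts for at most (x/n)^sg, and n = d m with m smooth. *)
Lemma rankin_count sg x (d y : nat) : 3 / 4 <= sg -> 1 <= x -> (0 < d)%N ->
  (\sum_(1 <= n < (Num.truncn x).+1 | (d %| n)%N && (upto y).-nat n) 1 : R) <=
  expR (sg * ln x) * powN sg d *
    expR (\sum_(0 <= q < y.+1 | prime q) powN sg q + 6).
Proof.
move=> sg0 x1 d0; have x0 : 0 < x by lra.
apply: (@le_trans _ _ (\sum_(1 <= n < (Num.truncn x).+1 | (d %| n)%N && (upto y).-nat n) (expR (sg * ln x) * powN sg n))).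
  rewrite big_nat_cond [leRHS]big_nat_cond; apply: ler_sum => n /andP[/andP[n0 nx] _].
  rewrite /powN -expRD -[leLHS]expR0 ler_expR -mulrBr mulr_ge0 //; first lra.
  rewrite subr_ge0 ler_ln ?posrE ?ltr0n //.
  by rewrite -truncn_ge_nat ?ltW.
rewrite -mulr_sumr -mulrA ler_wpM2l ?expR_ge0 //.
apply: le_trans (ler_wpM2l (ltW (powN_gt0 sg d)) (rankin_euler y (Num.truncn x) sg0)).
rewrite mulr_sumr -[leLHS]big_filter -[leRHS]big_filter.
set s := [seq m <- index_iota 1 _ | (upto y).-nat m].
have -> : \sum_(m <- s) powN sg d * powN sg m = \sum_(n <- map (muln d) s) powN sg n.
  rewrite big_map; apply: eq_big_seq => m; rewrite mem_filter mem_index_iota => /and3P[_ m0 _].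
  by rewrite powNM.
apply: sum_subset_le => [||n]; first by rewrite filter_uniq // iota_uniq.
  move=> n; rewrite mem_filter mem_index_iota => /and3P[/andP[/dvdnP[k nk] sn] n0 nM].
  apply/mapP; exists k; last by rewrite nk mulnC.
  have k0 : (0 < k)%N by move: n0; rewrite nk muln_gt0 => /andP[].
  rewrite mem_filter mem_index_iota k0 (@upto_dvd _ k d) ?[(d * k)%N]mulnC -?nk //=.
  by apply: leq_ltn_trans nM; rewrite nk leq_pmulr.
by rewrite ltW // powN_gt0.
Qed.
End Rankin.

(** * Integers not dividing the factorial of their largest prime factor *)

(** Used with a q > p: a high power of a small prime is never cheaper than p^2,
    up to a constant. *)
Lemma sqr_mul_le_exp (a q : nat) : (1 < a)%N -> (1 < q)%N -> ((a * q) ^ 2 <= 5 * q ^ a)%N.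
Proof.
move=> a1 q1; case: a a1 => [|[|[|a]]] // _.
  by rewrite expnMn; apply: leq_mul.
elim: a => [|a IH].
  rewrite expnMn [(q ^ 3)%N]expnS mulnA; apply: leq_mul => //; lia.
rewrite [(q ^ a.+1.+3)%N]expnS mulnCA; apply: leq_trans (leq_mul (leqnn q) IH).
rewrite !expnMn mulnA; apply: leq_mul => //; nia.
Qed.

(** If the prime q <= p has a larger exponent in n than in p!, where p divides n,
    then n is divisible by this number: p itself has exponent 1 in p!, and q has
    exponent at least p %/ q. *)
Definition forced_divisor (p q : nat) : nat := (if q == p then p ^ 2 else p * q ^ (p %/ q).+1)%N.

Lemma forced_divisor_gt0 (p q : nat) : (0 < p)%N -> (0 < q)%N -> (0 < forced_divisor p q)%N.
Proof. by move=> p0 q0; rewrite /forced_divisor; case: ifP; rewrite ?muln_gt0 ?expn_gt0 ?p0 ?q0. Qed.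

(** The cases q < p are rarer than the case where p^2 divides n by a factor of
    order p, which pays for summing over all q < p. *)
Lemma forced_divisor_ge (p q : nat) : prime q -> (q < p)%N -> (p ^ 3 <= 5 * forced_divisor p q)%N.
Proof.
move=> pq qp; rewrite /forced_divisor ltn_eqF // expnS mulnCA; apply: leq_mul => //.
apply: leq_trans (sqr_mul_le_exp _ (prime_gt1 pq)); last by rewrite ltnS divn_gt0 ?prime_gt0 // ltnW.
by rewrite leq_exp2r // ltnW // ltn_ceil // prime_gt0.
Qed.

(** The reason for n not to divide p! is located at one prime q. *)
Lemma forced_divisor_dvdn (n : nat) : (1 < n)%N -> ~~ (n %| (max_pdiv n)`!)%N ->
  exists q, [/\ prime q, (q <= max_pdiv n)%N & (forced_divisor (max_pdiv n) q %| n)%N].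
Proof.
move=> n1 nd; set p := max_pdiv n in nd *.
have n0 : (0 < n)%N by lia.
have pp : prime p by apply: max_pdiv_prime.
have : ~ forall q, q \in \pi(n) -> (n`_q %| p`!)%N by move=> /(dvdn_partP _ n0) h; rewrite h in nd.
move=> /existsNP[q /not_implyP[qn /negP nq]].
have pq : prime q by move: qn; rewrite mem_primes => /andP[].
have qp : (q <= p)%N by apply: max_pdiv_max.
exists q; split=> //.
have lg : (logn q p`! < logn q n)%N.
  by move: nq; rewrite p_part pfactor_dvdn ?fact_gt0 // -ltnNge.
have lq : (p %/ q <= logn q p`!)%N.
  by rewrite logn_fact // big_ltn ?ltnS ?(prime_gt0 pp) // expn1 leq_addr.
have qdv : (q ^ (p %/ q).+1 %| n)%N by rewrite pfactor_dvdn //; apply: leq_trans lg.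
rewrite /forced_divisor; case: eqP => [e|/eqP ne].
  by move: qdv; rewrite e divnn prime_gt0.
rewrite Gauss_dvd ?qdv ?andbT ?max_pdiv_dvd //.
by rewrite coprimeXr // prime_coprime // dvdn_prime2 // eq_sym.
Qed.

Lemma term_le_sum (R : realType) (T : eqType) (s : seq T) (P : pred T) (F : T -> R) x :
  x \in s -> P x -> (forall x, 0 <= F x) -> F x <= \sum_(y <- s | P y) F y.
Proof.
move=> xs Px F0; rewrite big_mkcond (big_rem x) //= Px lerDl.
by apply: sumr_ge0 => y _; case: ifP.
Qed.

Section UnionBound.
Variable R : realType.
Implicit Types (a b c x y z t th r sg : R) (n p q i J : nat).

Lemma sum_multiples_le x d : 1 <= x -> (0 < d)%N ->
  (\sum_(1 <= n < (Num.truncn x).+1 | (d %| n)%N) 1 : R) <= x / d%:R.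
Proof.
move=> x1 d0; set M := Num.truncn x.
have d0' : (0 : R) < d%:R by rewrite ltr0n.
apply: (@le_trans _ _ (\sum_(n <- map (muln d) (index_iota 1 (M %/ d).+1)) 1)).
  rewrite -big_filter; apply: sum_subset_le => //; first by rewrite filter_uniq // iota_uniq.
  move=> n; rewrite mem_filter mem_index_iota => /and3P[/dvdnP[k nk] n0 nM].
  apply/mapP; exists k; last by rewrite nk mulnC.
  rewrite mem_index_iota ltnS leq_divRL // -nk; apply/andP; split; last by rewrite -ltnS.
  by move: n0; rewrite nk muln_gt0 => /andP[].
rewrite big_map sumr_const_nat subn1 /= ler_pdivlMr // -natrM.
by rewrite -truncn_ge_nat ?leq_trunc_div //; lra.
Qed.

Lemma sum_inv_sqr_le (K P : nat) : (0 < K)%N ->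
  \sum_(K.+1 <= p < P) ((p%:R : R) ^- 2) <= K%:R^-1.
Proof.
move=> K0; have [h|h] := leqP P K.+1; first by rewrite big_geq // invr_ge0.
suff : \sum_(K.+1 <= p < P) ((p%:R : R) ^- 2) <= K%:R^-1 - P.-1%:R^-1.
  by move=> /le_trans; apply; rewrite gerBl invr_ge0.
case: P h => // P; rewrite ltnS /= => /ltnW.
elim: P => [|P IH KP]; first by rewrite leqNgt K0.
rewrite leq_eqVlt in KP; case/orP: KP => [/eqP <-|]; first by rewrite big_geq // subrr.
rewrite ltnS => KP.
rewrite big_nat_recr //=; apply: le_trans (lerD (IH KP) (lexx _)) _.
have P0 : (0 : R) < P%:R by rewrite ltr0n; lia.
suff : (P.+1%:R ^- 2 : R) <= P%:R^-1 - P.+1%:R^-1.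
  by move: (P.+1%:R ^- 2) (P.+1%:R^-1) => u v; lra.
rewrite -[P.+1%:R]natr1; move: (P%:R : R) P0 => u u0.
have -> : u^-1 - (u + 1)^-1 = (u * (u + 1))^-1 by field; apply/andP; split; apply/eqP; lra.
by rewrite lef_pV2 ?posrE ?mulr_gt0 ?exprn_gt0 ?addr_gt0 //; nra.
Qed.

Lemma prime_sum0E z F : prime_sum 0 z F = \sum_(0 <= q < (Num.truncn z).+1 | prime q) F q.
Proof. by rewrite /prime_sum truncn0 [RHS]big_ltn_cond. Qed.

(** The integers with largest prime factor at most y are only counted as smooth
    integers; for the others the pair (p, q) is recorded. *)
Lemma count_union_bound x (y P : nat) : (Num.truncn x <= P)%N ->
  ((N x)%:R : R) <=
   \sum_(1 <= n < (Num.truncn x).+1 | (1 %| n)%N && (upto y).-nat n) 1 +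
   \sum_(y.+1 <= p < P.+1 | prime p) \sum_(0 <= q < p.+1 | prime q)
     \sum_(1 <= n < (Num.truncn x).+1 | (forced_divisor p q %| n)%N && (upto p).-nat n) 1.
Proof.
move=> MP; set M := Num.truncn x.
have -> : ((N x)%:R : R) = \sum_(2 <= n < M.+1 | ~~ (n %| (max_pdiv n)`!)%N) 1.
  by rewrite /N -sum1_count natr_sum.
have -> : \sum_(2 <= n < M.+1 | ~~ (n %| (max_pdiv n)`!)%N) (1 : R) =
    \sum_(1 <= n < M.+1 | (1 < n)%N && ~~ (n %| (max_pdiv n)`!)%N) 1.
  case: M => [|k]; first by rewrite !big_geq.
  rewrite [RHS]big_ltn_cond //= big_nat_cond [RHS]big_nat_cond; apply: eq_bigl => n.
  by apply: andb_id2l => /andP[-> _].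
pose b p q n : R := if (forced_divisor p q %| n)%N && (upto p).-nat n then 1 else 0.
have b0 p q n : 0 <= b p q n by rewrite /b; case: ifP.
have -> : \sum_(y.+1 <= p < P.+1 | prime p) \sum_(0 <= q < p.+1 | prime q)
     \sum_(1 <= n < M.+1 | (forced_divisor p q %| n)%N && (upto p).-nat n) 1 =
   \sum_(1 <= n < M.+1) \sum_(y.+1 <= p < P.+1 | prime p) \sum_(0 <= q < p.+1 | prime q) b p q n.
  rewrite [RHS]exchange_big; apply: eq_bigr => p _ /=.
  rewrite [RHS]exchange_big; apply: eq_bigr => q _ /=.
  by rewrite big_mkcond.
rewrite big_mkcond [X in _ <= X + _]big_mkcond -big_split /=; apply: ler_sum_nat => n /andP[n0 nM].
have s0 : 0 <= \sum_(y.+1 <= p < P.+1 | prime p) \sum_(0 <= q < p.+1 | prime q) b p q n.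
  by apply: sumr_ge0 => p _; apply: sumr_ge0 => q _.
case: ifP => [/andP[n1 nd]|_]; last by rewrite addr_ge0 //; case: ifP.
have pp := max_pdiv_prime n1; have [q [pq qp qn]] := forced_divisor_dvdn n1 nd.
have sm (y' : nat) : (max_pdiv n <= y')%N -> (upto y').-nat n.
  move=> h; apply/pnatP => // r pr rn; rewrite inE /=; apply: leq_trans h.
  by apply: max_pdiv_max; rewrite mem_primes pr n0.
case: ifPn => [_|]; first by rewrite lerDl.
rewrite dvd1n /= => nsm; rewrite add0r.
have py : (y < max_pdiv n)%N by rewrite ltnNge; apply: contra nsm => /sm.
apply: (@le_trans _ _ (\sum_(0 <= q < (max_pdiv n).+1 | prime q) b (max_pdiv n) q n)).
  apply: (@le_trans _ _ (b (max_pdiv n) q n)); first by rewrite /b qn sm.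
  by apply: (@term_le_sum _ _ _ _ (fun q => b (max_pdiv n) q n)) => //; rewrite mem_index_iota.
apply: (@term_le_sum _ _ _ _ (fun p => \sum_(0 <= q < p.+1 | prime q) b p q n)) => //.
  rewrite mem_index_iota py ltnS /=; apply: leq_trans MP; rewrite -ltnS.
  by apply: leq_ltn_trans nM; apply: max_pdiv_leq.
by move=> p; apply: sumr_ge0.
Qed.
End UnionBound.

Section UpperBound.
Variable R : realType.
Implicit Types (a b c x y z t th r sg : R) (n p q i J : nat).

(** As p^(- sg) = p^(-1) exp t, the divisor p^2 costs exp (2 t)/p^2; the p - 1
    other primes cost at most 5 exp (3 t)/p^3 each. *)
Lemma powN_forced_divisor_sum_le t (p : nat) : prime p -> 0 < t -> 4 * t <= ln (p%:R : R) ->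
  \sum_(0 <= q < p.+1 | prime q) powN (1 - t / ln (p%:R : R)) (forced_divisor p q) <=
  6 * expR (3 * t) * p%:R ^- 2.
Proof.
move=> pp t0; set v := ln _ => tv; set sg := 1 - _.
have p0 : (0 < p)%N by apply: prime_gt0.
have p0' : (0 : R) < p%:R by rewrite ltr0n.
have v0 : 0 < v by lra.
have tv4 : t / v <= 1 / 4 by rewrite ler_pdivrMr //; lra.
have tv0 : 0 < t / v by rewrite divr_gt0.
have pe : expR v = p%:R by rewrite lnK.
have svE : sg * v = v - t by rewrite /sg mulrBl mul1r divfK // gt_eqF.
have main : powN sg (forced_divisor p p) <= expR (3 * t) * p%:R ^- 2.
  rewrite /forced_divisor eqxx /powN natrX lnXn // -pe -expRM_natr -expRN -expRD ler_expR expRK.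
  have -> : sg * (v *+ 2) = 2 * (sg * v) by ring.
  rewrite svE; lra.
have other q : prime q -> (q < p)%N -> powN sg (forced_divisor p q) <= p%:R^-1 * (5 * expR (3 * t) * p%:R ^- 2).
  move=> pq qp; have h := forced_divisor_ge pq qp.
  have e0 : (0 : R) < (forced_divisor p q)%:R by rewrite ltr0n forced_divisor_gt0 ?prime_gt0.
  have : 3 * v - ln 5 <= ln ((forced_divisor p q)%:R : R).
    rewrite lerBlDr -[_ + ln 5]addrC -lnM ?posrE // mulr_natl -lnXn //.
    by rewrite ler_ln ?posrE ?exprn_gt0 ?mulr_gt0 // -natrX -natrM ler_nat.
  move=> h2; have -> : p%:R^-1 * (5 * expR (3 * t) * p%:R ^- 2) = expR (- (3 * v - 3 * t - ln 5)).
    have -> : - (3 * v - 3 * t - ln 5) = ln 5 + 3 * t - v * 3%:R by ring.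
    rewrite expRD expRN expRM_natr pe expRD lnK ?posrE //.
    by field; rewrite gt_eqF.
  rewrite /powN ler_expR lerN2.
  have : sg * (3 * v - ln 5) <= sg * ln (forced_divisor p q)%:R by rewrite ler_wpM2l // /sg; lra.
  have l5 : 0 <= ln (5 : R) by rewrite ln_ge0 //; lra.
  have : sg * ln 5 <= ln 5 by rewrite ler_piMl // /sg; lra.
  rewrite mulrBr mulrCA svE; lra.
rewrite big_mkcond big_nat_recr //= -big_mkcond pp.
have -> : 6 * expR (3 * t) * p%:R ^- 2 = 5 * expR (3 * t) * p%:R ^- 2 + expR (3 * t) * p%:R ^- 2 by ring.
rewrite lerD //.
apply: (@le_trans _ _ (\sum_(0 <= q < p) p%:R^-1 * (5 * expR (3 * t) * p%:R ^- 2))).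
  rewrite big_mkcond; apply: ler_sum_nat => q /andP[_ qp]; case: ifP => pq; first exact: other.
  by rewrite !mulr_ge0 ?expR_ge0 ?invr_ge0 ?exprn_ge0 // ltW.
rewrite sumr_const_nat subn0 -[X in X <= _]mulr_natl mulrA divff ?mul1r // gt_eqF //.
Qed.

Lemma inv_forced_divisor_sum_le (p : nat) : prime p ->
  \sum_(0 <= q < p.+1 | prime q) ((forced_divisor p q)%:R : R)^-1 <= 6 * p%:R ^- 2.
Proof.
move=> pp; have p0 : (0 < p)%N by apply: prime_gt0.
have p0' : (0 : R) < p%:R by rewrite ltr0n.
rewrite big_mkcond big_nat_recr //= -big_mkcond pp.
have -> : 6 * p%:R ^- 2 = 5 * p%:R ^- 2 + p%:R ^- 2 :> R by ring.
rewrite lerD //; last by rewrite /forced_divisor eqxx natrX.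
apply: (@le_trans _ _ (\sum_(0 <= q < p) p%:R^-1 * (5 * p%:R ^- 2))).
  rewrite big_mkcond; apply: ler_sum_nat => q /andP[_ qp]; case: ifP => pq; last first.
    by rewrite !mulr_ge0 ?invr_ge0 ?exprn_ge0 // ltW.
  have e0 : (0 : R) < (forced_divisor p q)%:R by rewrite ltr0n forced_divisor_gt0 ?prime_gt0.
  have -> : p%:R^-1 * (5 * p%:R ^- 2) = (p%:R ^+ 3 / 5)^-1 :> R by field; rewrite gt_eqF.
  rewrite lef_pV2 ?posrE ?divr_gt0 ?exprn_gt0 // ler_pdivrMr //.
  by rewrite -natrX -natrM ler_nat mulnC forced_divisor_ge.
rewrite sumr_const_nat subn0 -[X in X <= _]mulr_natl mulrA divff ?mul1r // gt_eqF //.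
Qed.

(** The choice v = a gives equality: this is where the size of the dominant p
    comes from. *)
Lemma amgm_2 (a v : R) : 0 < v -> 2 * a <= v + a ^+ 2 / v.
Proof.
move=> v0; have -> : v + a ^+ 2 / v = 2 * a + (v - a) ^+ 2 / v by field; rewrite gt_eqF.
by rewrite lerDl divr_ge0 ?sqr_ge0 // ltW.
Qed.

(** The polynomial factors in E and exp t are absorbed by E/t^3. *)
Lemma upper_numerics (t x U A : R) : 0 < x -> 100 <= t -> 0 <= U ->
  A = x * (6 * expR (3 * t)) * expR (- (2 * expR t)) * expR (U + 6) ->
  6 * t <= expR t * t^-1 ^+ 3 ->
  x * expR (- (4 * expR t)) * expR (U + 6) + (A * (1 + 4 * expR t) + 12 * x * expR (- (4 * expR t))) <=
  x * expR (- (2 * expR t) + (U + expR t * t^-1 ^+ 3)).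
Proof.
move=> x0 t1 U0 AE; set E := expR t => E6.
have E0 : 0 < E by exact: expR_gt0.
have t0 : 0 < t by lra.
have E43 : 43 <= E by have := expR_ge1Dx t; rewrite -/E; lra.
have e2E : expR (- (2 * E)) <= 1 by rewrite expR_le1; lra.
set P := x * expR (- (2 * E)) * expR (U + 6).
have P0 : 0 <= P by rewrite !mulr_ge0 ?expR_ge0 // ltW.
have e3 : 1 <= expR (3 * t) by rewrite -[leLHS]expR0 ler_expR; lra.
have e6 : 1 <= expR (U + 6) by rewrite -[leLHS]expR0 ler_expR; lra.
have e44 : expR (- (4 * E)) = expR (- (2 * E)) * expR (- (2 * E)) by rewrite -expRD; congr expR; lra.
have PE : P <= P * (expR (3 * t) * E) by rewrite ler_peMr // -[leLHS]mulr1; apply: ler_pM => //; lra.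
have h1 : x * expR (- (4 * E)) * expR (U + 6) <= P.
  rewrite e44; have -> : x * (expR (- (2 * E)) * expR (- (2 * E))) * expR (U + 6) = expR (- (2 * E)) * P.
    by rewrite /P; ring.
  by rewrite ler_piMl.
have h3 : 12 * x * expR (- (4 * E)) <= 12 * P.
  rewrite -mulrA ler_wpM2l // e44 /P -[leRHS]mulrA ler_wpM2l ?(ltW x0) // ler_wpM2l ?expR_ge0 //; lra.
have h2 : A * (1 + 4 * E) <= 30 * (P * (expR (3 * t) * E)).
  have -> : A * (1 + 4 * E) = 6 * P * expR (3 * t) * (1 + 4 * E) by rewrite AE /P; ring.
  have -> : 30 * (P * (expR (3 * t) * E)) = 6 * P * expR (3 * t) * (5 * E) by ring.
  rewrite ler_wpM2l ?mulr_ge0 ?expR_ge0 //; lra.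
apply: (@le_trans _ _ (43 * (P * (expR (3 * t) * E)))); first lra.
apply: (@le_trans _ _ (expR t * (P * (expR (3 * t) * E)))).
  by rewrite ler_wpM2r // !mulr_ge0 ?expR_ge0 // ltW.
have -> : expR t * (P * (expR (3 * t) * E)) =
   x * (expR (- (2 * E)) * expR (U + 6) * (expR t * expR (3 * t) * expR t)) by rewrite /P /E; ring.
rewrite ler_wpM2l ?(ltW x0) // -!expRD ler_expR.
lra.
Qed.

(** Three ranges of p. Up to exp (E/4), n is so smooth that Rankin's bound gives
    x exp (- 4E) apart from the common factor. Up to exp (4E), the bound for each
    p = exp v is x/p times exp (- v - E^2/v), hence at most exp (- 2E) by
    the inequality of the means, and the sum of 1/p only costs 1 + 4E. Beyond,
    the trivial count of the multiples of a number of order p^2 suffices. *)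
Lemma N_upper t x : large t -> 0 < x -> ln x = expR t ^+ 2 / t ->
  (N x)%:R <= x * expR (- (2 * expR t) + expR t * (t^-1 + t^-1 ^+ 2 + 41 * t^-1 ^+ 3)).
Proof.
move=> lt x0 lx; have [t1 _] := lt; have E1 := large_expR lt; set E := expR t in E1 lx *.
have t0 : 0 < t by lra.
have Et : t * 100 <= E.
  apply: le_trans E1; have := @exprS_le R t 1 20 t1 isT; rewrite expr1 => h; apply: le_trans h.
  rewrite mulrC ler_wpM2r ?(ltW t0) // -[leLHS]expr1 ler_eXn2l //; lra.
have E0 : 0 < E by exact: expR_gt0.
have x1 : 1 <= x.
  by rewrite -ler_ln ?posrE ?ltr01 // ln1 lx divr_ge0 ?sqr_ge0 // ltW.
set U := E * (t^-1 + t^-1 ^+ 2 + 40 * t^-1 ^+ 3).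
have t50 : 0 <= t ^+ 5 by rewrite exprn_ge0 // ltW.
pose J := (Num.truncn (t ^+ 5)).+1.
have J1 : t ^+ 5 <= J%:R by rewrite ltW // truncnS_gt.
have J2 : J%:R <= t ^+ 5 + 1.
  by rewrite -natr1 lerD2r; have /andP[] := truncn_itv t50.
have PS v : E / 4 <= v -> v <= 4 * E -> prime_sum 0 (expR v) (powN (1 - t / v)) <= U.
  by move=> v1 v2; apply: (tilted_prime_sum_le lt J1 J2).
have sgx v : 0 < v -> (1 - t / v) * ln x = ln x - E ^+ 2 / v.
  by move=> v0; rewrite mulrBl mul1r lx; congr (_ - _); field; rewrite !gt_eqF.
set y := Num.truncn (expR (E / 4)).
set K := Num.truncn (expR (4 * E)).
set M := Num.truncn x.
have := @count_union_bound R x y (M + K) (leq_addr _ _); rewrite -/M.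
set S1 := \sum_(1 <= n < _ | _) 1; set S2 := \sum_(_ <= p < _ | _) _ => hN.
have b1 : S1 <= x * expR (- (4 * E)) * expR (U + 6).
  have v0 : 0 < E / 4 by lra.
  have sg0 : 3 / 4 <= 1 - t / (E / 4).
    have : t / (E / 4) <= 1 / 4 by rewrite ler_pdivrMr //; lra.
    lra.
  apply: le_trans (rankin_count y sg0 x1 (leqnn 1)) _.
  have -> : powN (1 - t / (E / 4)) 1 = 1 by rewrite /powN ln1 mulr0 oppr0 expR0.
  rewrite mulr1 sgx // expRD lnK ?posrE //.
  have -> : E ^+ 2 / (E / 4) = 4 * E by field; rewrite gt_eqF.
  apply: ler_wpM2l; first by rewrite mulr_ge0 ?expR_ge0 // ltW.
  by rewrite ler_expR lerD2r -prime_sum0E PS //; lra.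
set A := x * (6 * expR (3 * t)) * expR (- (2 * E)) * expR (U + 6).
have A0 : 0 <= A by rewrite !mulr_ge0 ?expR_ge0 // ltW.
have e4 : 1 <= expR (4 * E) by rewrite -[leLHS]expR0 ler_expR; lra.
have K0 : (0 < K)%N by rewrite truncn_gt0.
have K0' : (0 : R) < K%:R by rewrite ltr0n.
have /andP[K1 K2] := truncn_itv (expR_ge0 (4 * E)); rewrite -/K in K1 K2.
have mid p : prime p -> (y < p)%N -> (p <= K)%N ->
    \sum_(0 <= q < p.+1 | prime q)
     \sum_(1 <= n < M.+1 | (forced_divisor p q %| n)%N && (upto p).-nat n) 1 <= A * p%:R^-1.
  move=> pp yp pK; have p0 : (0 < p)%N by apply: prime_gt0.
  have p0' : (0 : R) < p%:R by rewrite ltr0n.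
  set v := ln (p%:R : R); have pe : expR v = p%:R by rewrite lnK.
  have v1 : E / 4 <= v.
    rewrite -ler_expR pe ltW // (lt_le_trans (truncnS_gt _)) // ler_nat //.
  have v2 : v <= 4 * E.
    by rewrite -ler_expR pe; apply: le_trans K1; rewrite ler_nat.
  have v0 : 0 < v by lra.
  have sg0 : 3 / 4 <= 1 - t / v.
    have : t / v <= 1 / 4 by rewrite ler_pdivrMr //; lra.
    lra.
  apply: (@le_trans _ _ (\sum_(0 <= q < p.+1 | prime q)
      expR ((1 - t / v) * ln x) * powN (1 - t / v) (forced_divisor p q) * expR (U + 6))).
    apply: ler_sum => q pq.
    apply: le_trans (rankin_count p sg0 x1 (forced_divisor_gt0 p0 (prime_gt0 pq))) _.
    apply: ler_wpM2l; first by rewrite mulr_ge0 ?expR_ge0 // ltW ?powN_gt0.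
    rewrite ler_expR lerD2r -[X in index_iota 0 X.+1](@natrK R) -prime_sum0E -pe PS //.
  rewrite -mulr_suml -mulr_sumr /A sgx // expRD lnK ?posrE //.
  have tv4 : 4 * t <= v by lra.
  have h := powN_forced_divisor_sum_le pp t0 tv4; rewrite -/v in h.
  have h2 := amgm_2 E v0.
  apply: (@le_trans _ _ (x * expR (- (E ^+ 2 / v)) * (6 * expR (3 * t) * p%:R ^- 2) * expR (U + 6))).
    rewrite ler_wpM2r ?expR_ge0 // ler_wpM2l //.
    by rewrite mulr_ge0 ?expR_ge0 // ltW.
  have -> : p%:R ^- 2 = p%:R^-1 * expR (- v) by rewrite expRN pe -invfM -expr2.
  have -> : x * expR (- (E ^+ 2 / v)) * (6 * expR (3 * t) * (p%:R^-1 * expR (- v))) * expR (U + 6) =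
     x * (6 * expR (3 * t)) * (expR (- (E ^+ 2 / v)) * expR (- v)) * expR (U + 6) / p%:R by ring.
  rewrite ler_wpM2r ?invr_ge0 ?ler0n // ler_wpM2r ?expR_ge0 // ler_wpM2l //.
    by rewrite !mulr_ge0 ?expR_ge0 // ltW.
  rewrite -expRD ler_expR; lra.
have high p : prime p ->
    \sum_(0 <= q < p.+1 | prime q)
     \sum_(1 <= n < M.+1 | (forced_divisor p q %| n)%N && (upto p).-nat n) 1 <= 6 * x * p%:R ^- 2.
  move=> pp; have p0 : (0 < p)%N by apply: prime_gt0.
  apply: (@le_trans _ _ (\sum_(0 <= q < p.+1 | prime q) x * (forced_divisor p q)%:R^-1)).
    apply: ler_sum => q pq.
    apply: le_trans (sum_multiples_le x1 (forced_divisor_gt0 p0 (prime_gt0 pq))).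
    rewrite big_mkcond [leRHS]big_mkcond; apply: ler_sum => n _.
    by case: (forced_divisor p q %| n)%N => //=; case: ifP.
  rewrite -mulr_sumr [6 * x]mulrC -mulrA ler_wpM2l ?(ltW x0) //; exact: inv_forced_divisor_sum_le.
have b2 : S2 <= A * (1 + 4 * E) + 12 * x * expR (- (4 * E)).
  apply: (@le_trans _ _ (\sum_(1 <= p < K.+1) A * p%:R^-1 + \sum_(K.+1 <= p < (M + K).+1) 6 * x * p%:R ^- 2)).
    have KM : (K.+1 <= (M + K).+1)%N by rewrite ltnS leq_addl.
    (* K may exceed x; summing up to M + K treats both cases at once. *)
    pose F p : R := if (p <= K)%N then A * p%:R^-1 else 6 * x * p%:R ^- 2.
    have F0 p : 0 <= F p.
      by rewrite /F; case: ifP => _; rewrite !mulr_ge0 ?invr_ge0 ?exprn_ge0 // ltW.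
    apply: (@le_trans _ _ (\sum_(1 <= p < (M + K).+1) F p)).
      apply: (@le_trans _ _ (\sum_(y.+1 <= p < (M + K).+1) F p)).
        rewrite /S2 big_mkcond; apply: ler_sum_nat => p /andP[yp _]; case: ifP => // pp.
        rewrite /F; case: ifP => [pK|_]; first exact: mid.
        exact: high.
      apply: sum_subset_le => //; first exact: iota_uniq.
      by move=> p; rewrite !mem_index_iota => /andP[yp ->]; rewrite andbT (leq_ltn_trans (leq0n y) yp).
    rewrite (@big_cat_nat _ _ _ K.+1) //=; apply: lerD; apply: ler_sum_nat => p /andP[p1 p2].
      by rewrite /F -ltnS p2.
    by rewrite /F leqNgt p1.
  apply: lerD.
    rewrite -mulr_sumr ler_wpM2l //; apply: le_trans (harmonic_le _ _) _.
    by rewrite lerD2l -ler_expR lnK ?posrE.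
  rewrite -mulr_sumr.
  apply: (@le_trans _ _ (6 * x * K%:R^-1)).
    by rewrite ler_wpM2l ?sum_inv_sqr_le // mulr_ge0 // ltW.
  have -> : 12 * x * expR (- (4 * E)) = 6 * x * (2 * expR (- (4 * E))) by ring.
  rewrite ler_wpM2l ?mulr_ge0 ?(ltW x0) // expRN -[leLHS]mul1r ler_pdivrMr //.
  rewrite mulrAC ler_pdivlMr ?expR_gt0 // mul1r.
  have : (1 : R) <= K%:R by rewrite ler1n.
  by move: K2; rewrite -natr1; lra.
apply: le_trans hN _; apply: le_trans (lerD b1 b2) _.
have E6 : 6 * t <= E * t^-1 ^+ 3.
  rewrite exprVn ler_pdivlMr ?exprn_gt0 //; apply: le_trans E1.
  rewrite -mulrA -exprS; apply: le_trans (@exprS_le R t 4 20 t1 isT).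
  rewrite ler_wpM2r ?exprn_ge0 ?(ltW t0) //; apply: (@le_trans _ _ (100 ^+ 1)).
    by rewrite expr1 ler_nat.
  by rewrite ler_eXn2l // ltr1n.
have U0 : 0 <= U.
  have w0 : 0 <= t^-1 by rewrite invr_ge0 ltW.
  by rewrite mulr_ge0 ?(ltW E0) // addr_ge0 ?mulr_ge0 ?exprn_ge0 // addr_ge0 ?exprn_ge0.
have -> : E * (t^-1 + t^-1 ^+ 2 + 41 * t^-1 ^+ 3) = U + E * t^-1 ^+ 3 by rewrite /U; ring.
exact: (upper_numerics x0 t1 U0 (erefl _) E6).
Qed.
End UpperBound.

(** * Estimates for one block of primes *)

Section Estimates.
Variable R : realType.
Implicit Types (a b x y z t th : R) (p q i J : nat).

(** Unlike k! <= k^k, this keeps the linear term, which is the source of the factor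
    exp K in the lower bound. *)
Lemma ln_fact_sharp k : (0 < k)%N ->
  ln ((k`!)%:R : R) <= k.+1%:R * ln k%:R - k%:R + 1.
Proof.
elim: k => // k IH _; have [->|k0] := posnP k; first by rewrite !ln1; lra.
rewrite factS natrM lnM ?posrE ?ltr0n ?fact_gt0 //.
apply: le_trans (lerD (lexx _) (IH k0)) _.
have k0' : (0 : R) < k%:R by rewrite ltr0n.
have h : 1 <= (k.+1%:R : R) * (ln k.+1%:R - ln k%:R).
  have : ln (k%:R / k.+1%:R : R) <= k%:R / k.+1%:R - 1 by apply: ln_le_subr1; rewrite divr_gt0.
  rewrite ln_div ?posrE // => /(ler_wpM2l (ler0n R k.+1)) h.
  have e : (k.+1%:R : R) * (k%:R / k.+1%:R - 1) = k%:R - k.+1%:R.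
    by field; rewrite gt_eqF // addr_gt0.
  have e1 : (k.+1%:R : R) = k%:R + 1 by rewrite natr1.
  by move: h; rewrite e mulrBr mulrBr; lra.
rewrite -[k.+2%:R]natr1; move: (ln k.+1%:R) (ln k%:R) h => l1 l2.
rewrite -[k.+1%:R]natr1; lra.
Qed.

(** Choosing k factors out of a set of total weight S gives S^k/k!; with
    k = S exp a this is exp (k - k a) up to a factor of order b. *)
Lemma powX_div_fact_ge (S a b : R) (k : nat) : 0 <= S -> 1 <= b ->
  k%:R <= b -> k%:R * expR (- a) <= S ->
  expR (k%:R - k%:R * a - 1 - ln b) <= S ^+ k / k`!%:R.
Proof.
move=> S0 b1 kb kS; have lb := ln_ge0 b1.
have [->|k0] := posnP k; first by rewrite expr0 fact0 divr1 expR_le1; lra.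
have k0' : (0 : R) < k%:R by rewrite ltr0n.
have S1 : 0 < S by apply: lt_le_trans kS; rewrite mulr_gt0 ?expR_gt0.
have f0 : (0 : R) < k`!%:R by rewrite ltr0n fact_gt0.
rewrite -[leRHS]lnK ?posrE ?divr_gt0 ?exprn_gt0 // ler_expR ln_div ?posrE ?exprn_gt0 //.
rewrite lnXn // -[ln S *+ k]mulr_natl.
have := ln_fact_sharp k0; rewrite -[k.+1%:R]natr1 => h1.
have h2 : ln (k%:R : R) <= ln b by rewrite ler_ln // posrE; lra.
have h3 : ln (k%:R * expR (- a)) <= ln S by rewrite ler_ln // posrE mulr_gt0 ?expR_gt0.
rewrite lnM ?posrE ?expR_gt0 // expRK in h3.
have : k%:R * (ln k%:R + - a) <= k%:R * ln S by rewrite ler_wpM2l // ltW.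
rewrite mulrDr; lra.
Qed.

Lemma prime_sum_inv_block_ge (W : R) (j : nat) : 0 < W ->
  (W - 20) / (W * j.+1%:R) <=
  prime_sum (expR (W * j%:R)) (expR (W * j.+1%:R)) (fun q => q%:R^-1).
Proof.
move=> W0; have j0' : (0 : R) < j.+1%:R by rewrite ltr0n.
have h1 : 1 <= expR (W * j%:R) by rewrite -[leLHS]expR0 ler_expR mulr_ge0 // ltW.
have h2 : expR (W * j%:R) <= expR (W * j.+1%:R) by rewrite ler_expR ler_wpM2l ?(ltW W0) // ler_nat.
have /andP[+ _] := prime_sum_mertens h1 h2; rewrite !expRK => h3.
have h4 : W - 20 <= prime_sum (expR (W * j%:R)) (expR (W * j.+1%:R)) (fun q => ln q%:R / q%:R).
  by apply: le_trans h3; rewrite -[j.+1%:R]natr1; lra.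
rewrite ler_pdivrMr ?mulr_gt0 // mulrC; apply: le_trans h4 _.
rewrite -prime_sum_mull; apply: prime_sum_le; rewrite ?expR_ge0 // => q pq q1 q2.
have q0 : (0 : R) < q%:R by rewrite ltr0n prime_gt0.
by rewrite ler_wpM2r ?invr_ge0 // -ler_expR lnK.
Qed.

(** Shifting the interval by 21 on the logarithmic scale makes Mertens' estimate
    non trivial, so there are primes just above exp Y. *)
Lemma prime_inv_sqr_ge (Y : R) : 1 <= Y ->
  expR (- Y - 21) / (Y + 21) <= prime_sum (expR Y) (expR (Y + 21)) (fun p => p%:R ^- 2).
Proof.
move=> Y1; have h1 : 1 <= expR Y by rewrite -[leLHS]expR0 ler_expR; lra.
have h2 : expR Y <= expR (Y + 21) by rewrite ler_expR; lra.
have /andP[+ _] := prime_sum_mertens h1 h2; rewrite !expRK => h3.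
have h4 : 1 <= prime_sum (expR Y) (expR (Y + 21)) (fun q => ln q%:R / q%:R) by apply: le_trans h3; lra.
have c0 : 0 <= expR (- Y - 21) / (Y + 21) by rewrite divr_ge0 ?expR_ge0 //; lra.
apply: le_trans (_ : expR (- Y - 21) / (Y + 21) * prime_sum (expR Y) (expR (Y + 21)) (fun q => ln q%:R / q%:R) <= _).
  by rewrite ler_peMr.
rewrite -prime_sum_mull; apply: prime_sum_le; rewrite ?expR_ge0 // => q pq q1 q2.
have q0 : (0 : R) < q%:R by rewrite ltr0n prime_gt0.
have l2 : ln (q%:R : R) <= Y + 21 by rewrite -ler_expR lnK.
have l0 := ln_nat_ge0 R q.
have -> : expR (- Y - 21) / (Y + 21) * (ln q%:R / q%:R) = expR (- Y - 21) * (ln q%:R / (Y + 21)) / q%:R.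
  by field; apply/andP; split; apply/eqP; lra.
rewrite expr2 invfM ler_wpM2r ?invr_ge0 //.
apply: (@le_trans _ _ (expR (- Y - 21) * 1)).
  by rewrite ler_wpM2l ?expR_ge0 // ler_pdivrMr ?mul1r //; lra.
have -> : - Y - 21 = - (Y + 21) by ring.
by rewrite mulr1 expRN lef_pV2 ?posrE ?expR_gt0.
Qed.
End Estimates.

(** * Products of primes from a given set *)

Definition prime_supp (P : pred nat) (n : nat) : Prop :=
  (0 < n)%N /\ forall p, prime p -> (p %| n)%N -> P p.

Lemma prime_supp1 P : prime_supp P 1.
Proof. by split=> // p pp; rewrite dvdn1 => /eqP e; rewrite e in pp. Qed.

Lemma prime_suppM P m n : prime_supp P m -> prime_supp P n -> prime_supp P (m * n).
Proof.
move=> [m0 hm] [n0 hn]; split=> [|p pp]; first by rewrite muln_gt0 m0.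
by rewrite Euclid_dvdM // => /orP[]; [exact: hm | exact: hn].
Qed.

Lemma prime_supp_prime (P : pred nat) p : prime p -> P p -> prime_supp P p.
Proof. by move=> pp Pp; split=> [|q pq]; rewrite ?prime_gt0 // dvdn_prime2 // => /eqP ->. Qed.

Lemma prime_supp_sub (P Q : pred nat) n : (forall p, prime p -> P p -> Q p) -> prime_supp P n -> prime_supp Q n.
Proof. by move=> h [n0 hn]; split=> // p pp pn; apply: h => //; apply: hn. Qed.

(** Unique factorisation: m is the part of the product supported on P. *)
Lemma prime_supp_split (P : pred nat) m m' b b' :
  prime_supp P m -> prime_supp P m' ->
  prime_supp (predC P) b -> prime_supp (predC P) b' ->
  (m * b = m' * b')%N -> m = m' /\ b = b'.
Proof.
move=> [m0 hm] [m'0 hm'] [b0 hb] [b'0 hb'] e; pose pi : nat_pred := SimplPred P.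
have pn k : (0 < k)%N -> (forall p, prime p -> (p %| k)%N -> P p) -> pi.-nat k.
  by move=> k0 hk; apply/pnatP => // p pp pk; rewrite inE /=; apply: hk.
have pc k : (0 < k)%N -> (forall p, prime p -> (p %| k)%N -> predC P p) ->
    (negn pi).-nat k.
  by move=> k0 hk; apply/pnatP => // p pp pk; rewrite !inE /=; apply: hk.
have em : m = m'.
  have := congr1 (fun n => n`_pi)%N e.
  rewrite !partnM // (part_pnat_id (pn _ m0 hm)) (part_pnat_id (pn _ m'0 hm')).
  by rewrite (part_p'nat (pc _ b0 hb)) (part_p'nat (pc _ b'0 hb')) !muln1.
split=> //; move: e; rewrite -em => /eqP; rewrite eqn_pmul2l //; exact: eqP.
Qed.

(** Multisets of k elements of Q, represented by their product; repetitions are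
    removed so that each product is counted once. *)
Fixpoint prime_products (Q : seq nat) (k : nat) : seq nat :=
  if k is k'.+1 then undup [seq (q * m)%N | q <- Q, m <- prime_products Q k'] else [:: 1%N].

Lemma prime_products_uniq Q k : uniq (prime_products Q k).
Proof. by case: k => //= k; exact: undup_uniq. Qed.

Lemma prime_products_ind Q (P : nat -> nat -> Prop) : P 0%N 1%N ->
  (forall k q m, q \in Q -> m \in prime_products Q k -> P k m -> P k.+1 (q * m)%N) ->
  forall k m, m \in prime_products Q k -> P k m.
Proof.
move=> P0 PS; elim=> [|k IH] m /=; first by rewrite inE => /eqP ->.
rewrite mem_undup => /allpairsP[[q n] /= [qQ nk ->]].
by apply: PS => //; apply: IH.
Qed.

Lemma prime_products_supp Q k m : all prime Q -> m \in prime_products Q k -> prime_supp (fun p => p \in Q) m.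
Proof.
move=> /allP aQ; move: k m; apply: prime_products_ind => [|k q m qQ mk IH]; first exact: prime_supp1.
by apply: prime_suppM => //; apply: prime_supp_prime => //; apply: aQ.
Qed.

(** This bounds the number of ways of splitting off one prime of Q, which is what
    produces the factorial in the next inequality. *)
Lemma prime_products_count Q k m : uniq Q -> all prime Q -> m \in prime_products Q k ->
  (count (fun q => q %| m)%N Q <= k)%N.
Proof.
move=> uQ /allP aQ; move: k m; apply: prime_products_ind => [|k q m qQ mk IH].
  by rewrite leqNgt -has_count; apply/hasPn => q /aQ; rewrite dvdn1; apply: contraTN => /eqP ->.
apply: (@leq_trans (count (fun q' => (q' == q) || (q' %| m)%N) Q)).
  rewrite -!size_filter; apply: uniq_leq_size; first exact: filter_uniq.
  move=> q'; rewrite !mem_filter => /andP[qm q'Q]; rewrite q'Q andbT.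
  by move: qm; rewrite Euclid_dvdM ?aQ // dvdn_prime2 ?aQ.
rewrite -[k.+1]add1n; apply: leq_trans (leq_add (leqnn 1) IH).
have := count_predUI (pred1 q) (fun q' => q' %| m)%N Q.
rewrite (count_uniq_mem _ uQ) qQ /= => <-; exact: leq_addr.
Qed.

Section PrimeProducts.
Variable R : realType.
Implicit Types (a b c x y z t th r sg : R) (n p q i J : nat).

Lemma prime_products_bounds (lo hi : R) Q k m : 0 <= lo ->
  (forall q, q \in Q -> lo <= q%:R <= hi) -> m \in prime_products Q k -> lo ^+ k <= m%:R <= hi ^+ k.
Proof.
move=> lo0 hQ; move: k m; apply: prime_products_ind => [|k q m qQ mk /andP[h1 h2]].
  by rewrite !expr0 lexx.
have /andP[q1 q2] := hQ _ qQ.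
by rewrite natrM !exprS; apply/andP; split; apply: ler_pM => //; apply: exprn_ge0.
Qed.

(** Expanding the power of the sum gives each product of k primes at most k!
    times. *)
Lemma prime_products_sum (f : nat -> R) Q k : uniq Q -> all prime Q ->
  f 1%N = 1 -> (forall n, 0 <= f n) ->
  (forall q m, (0 < q)%N -> (0 < m)%N -> f (q * m)%N = f q * f m) ->
  (\sum_(q <- Q) f q) ^+ k <= (k`!)%:R * \sum_(m <- prime_products Q k) f m.
Proof.
move=> uQ aQ f1 f0 fM; elim: k => [|k IH].
  by rewrite expr0 fact0 mul1r /= big_seq1 f1.
rewrite exprS factS natrM.
have h0 : 0 <= \sum_(q <- Q) f q by apply: sumr_ge0.
apply: le_trans (ler_wpM2l h0 IH) _.
rewrite mulrCA [_ * k`!%:R]mulrC -mulrA ler_wpM2l //.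
rewrite mulr_suml.
apply: (@le_trans _ _ (\sum_(q <- Q) \sum_(n <- prime_products Q k.+1 | (q %| n)%N) f n)).
  rewrite big_seq [leRHS]big_seq; apply: ler_sum => q qQ.
  have q0 : (0 < q)%N by apply: prime_gt0; apply: (allP aQ).
  rewrite mulr_sumr.
  have -> : \sum_(m <- prime_products Q k) f q * f m = \sum_(n <- map (muln q) (prime_products Q k)) f n.
    rewrite big_map; apply: eq_big_seq => m mk; rewrite fM //.
    by have [] := prime_products_supp aQ mk.
  rewrite -[leRHS]big_filter; apply: sum_subset_le => //.
    rewrite map_inj_uniq ?prime_products_uniq // => u v /eqP; rewrite eqn_pmul2l //; exact: eqP.
  move=> n /mapP[m mk ->]; rewrite mem_filter dvdn_mulr //= mem_undup.
  by apply/allpairsP; exists (q, m).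
rewrite (exchange_big_dep predT) //= mulr_sumr big_seq [leRHS]big_seq.
apply: ler_sum => n nk; rewrite big_const_seq iter_addr_0 -[f n *+ _]mulr_natl.
by rewrite ler_wpM2r // ler_nat; apply: prime_products_count.
Qed.
End PrimeProducts.

Section Construction.
Variable R : realType.
Implicit Types (a b x y z t th : R) (p q i J : nat).

Definition primes_in a b : seq nat :=
  [seq q <- index_iota (Num.truncn a).+1 (Num.truncn b).+1 | prime q].

Lemma primes_in_uniq a b : uniq (primes_in a b).
Proof. by rewrite filter_uniq // iota_uniq. Qed.

Lemma primes_in_prime a b : all prime (primes_in a b).
Proof. exact: filter_all. Qed.

Lemma mem_primes_in a b q : 0 <= a -> 0 <= b ->
  (q \in primes_in a b) = [&& prime q, a < q%:R & q%:R <= b].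
Proof. by move=> a0 b0; rewrite mem_filter mem_prime_range. Qed.

Lemma sum_primes_in a b F : \sum_(q <- primes_in a b) F q = prime_sum a b F.
Proof. by rewrite big_filter. Qed.

(** Primes from different blocks are told apart by size, so products over the
    blocks are distinct and the sum of 1/m factorises. *)
Lemma block_products (h : nat -> R) (k : nat -> nat) (a b : nat) :
  (forall j, 0 <= h j) -> (forall j, h j <= h j.+1) -> (a <= b)%N ->
  exists s : seq nat, [/\ uniq s,
    forall m, m \in s -> prime_supp (fun p => (h a < p%:R) && (p%:R <= h b)) m,
    forall m, m \in s ->
      \prod_(a <= j < b) h j ^+ k j <= m%:R <= \prod_(a <= j < b) h j.+1 ^+ k j &
    \prod_(a <= j < b) (prime_sum (h j) (h j.+1) (fun q => q%:R^-1) ^+ k j / (k j)`!%:R)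
      <= \sum_(m <- s) m%:R^-1].
Proof.
move=> h0 hS; elim: b => [|b IH] ab.
  move: ab; rewrite leqn0 => /eqP ->; exists [:: 1%N]; rewrite !big_geq // big_seq1.
  split=> // [m|m|]; rewrite ?inE ?invr1 // => /eqP ->; rewrite ?lexx //; exact: prime_supp1.
rewrite leq_eqVlt in ab; case/orP: ab => [/eqP ->|].
  exists [:: 1%N]; rewrite !big_geq // big_seq1.
  split=> // [m|m|]; rewrite ?inE ?invr1 // => /eqP ->; rewrite ?lexx //; exact: prime_supp1.
rewrite ltnS => ab; have [s [us ss sb sS]] := IH ab.
have hab : h a <= h b.
  by rewrite -(subnKC ab); elim: (b - a)%N => [|n]; rewrite ?addn0 ?addnS // => /le_trans; apply.
set Q := primes_in (h b) (h b.+1).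
have uQ : uniq Q by exact: primes_in_uniq.
have aQ : all prime Q by exact: primes_in_prime.
have Qh q : q \in Q -> h b <= q%:R <= h b.+1.
  by rewrite mem_primes_in // => /and3P[_ /ltW -> ->].
set s2 := prime_products Q (k b).
exists [seq (m * c)%N | m <- s, c <- s2].
have sup2 c : c \in s2 -> prime_supp (predC (fun p => p%:R <= h b)) c.
  move=> /(prime_products_supp aQ); apply: prime_supp_sub => p _.
  by rewrite mem_primes_in //= => /and3P[_ ? _]; rewrite -ltNge.
have us2 : uniq s2 by exact: prime_products_uniq.
split.
- apply: allpairs_uniq => // -[m c] [m' c'] /allpairsP[[m1 c1] /= [ms cs [-> ->]]].
  move=> /allpairsP[[m2 c2] /= [ms' cs' [-> ->]]] e.
  have sm n : n \in s -> prime_supp (fun p => p%:R <= h b) n.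
    by move=> /ss; apply: prime_supp_sub => p _ /andP[].
  by have [-> ->] := prime_supp_split (sm _ ms) (sm _ ms') (sup2 _ cs) (sup2 _ cs') e.
- move=> n /allpairsP[[m c] /= [ms cs ->]]; apply: prime_suppM.
    by apply: prime_supp_sub (ss _ ms) => p _ /andP[-> /le_trans]; apply.
  apply: prime_supp_sub (prime_products_supp aQ cs) => p _.
  by rewrite mem_primes_in //= => /and3P[_ p1 ->]; rewrite (le_lt_trans hab).
- move=> n /allpairsP[[m c] /= [ms cs ->]]; rewrite !big_nat_recr //= natrM.
  have /andP[m1 m2] := sb _ ms.
  have /andP[c1 c2] := prime_products_bounds (h0 b) Qh cs.
  by apply/andP; split; apply: ler_pM => //; rewrite ?exprn_ge0 ?prodr_ge0 // => j _; rewrite exprn_ge0.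
rewrite big_nat_recr //= big_allpairs_dep /=.
have -> : \sum_(i <- s) \sum_(j <- s2) ((i * j)%:R : R)^-1 =
   (\sum_(i <- s) (i%:R)^-1) * (\sum_(j <- s2) (j%:R)^-1).
  rewrite mulr_suml; apply: eq_bigr => i _; rewrite mulr_sumr; apply: eq_bigr => j _.
  by rewrite natrM invfM.
have P0 j : 0 <= prime_sum (h j) (h j.+1) (fun q => q%:R^-1 : R).
  by apply: sumr_ge0 => q _; rewrite invr_ge0.
apply: ler_pM => //.
- by apply: prodr_ge0 => j _; rewrite divr_ge0 // exprn_ge0.
- by rewrite divr_ge0 // exprn_ge0.
rewrite ler_pdivrMr ?ltr0n ?fact_gt0 // -sum_primes_in mulrC.
apply: prime_products_sum => // [|q m q0 m0]; first exact: invr1.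
by rewrite natrM invfM.
Qed.

(** Primes are taken from a short interval below z, so that products of T of them
    come within a factor exp (21 T) of z^T. *)
Lemma fill_count z (T : nat) : expR 21 <= z -> (0 < T)%N ->
  z ^+ T * expR (- (T%:R * (21 + ln (ln z) + ln T%:R))) <=
  (size (prime_products (primes_in (z * expR (- 21)) z) T))%:R.
Proof.
move=> z1 T0; set Q := primes_in _ _.
have e0 := expR_gt0 (21 : R); have z0 : 0 < z by apply: lt_le_trans z1.
have lz : 21 <= ln z by rewrite -ler_expR lnK.
have lz0 : 0 < ln z by lra.
have T0' : (0 : R) < T%:R by rewrite ltr0n.
have z21 : 1 <= z * expR (- 21) by rewrite expRN ler_pdivlMr // mul1r.
have z22 : z * expR (- 21) <= z by rewrite ler_piMr ?expR_le1 // ?ltW //; lra.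
have cQ : z / (expR 21 * ln z) <= (size Q)%:R.
  have /andP[h _] := prime_sum_mertens z21 z22.
  have h1 : 1 <= prime_sum (z * expR (- 21)) z (fun q => ln (q%:R) / q%:R).
    apply: le_trans h; rewrite lnM ?posrE ?expR_gt0 // expRK; lra.
  rewrite ler_pdivrMr ?mulr_gt0 //.
  have : prime_sum (z * expR (- 21)) z (fun q => ln (q%:R) / q%:R) <= (size Q)%:R * (ln z * expR 21 / z).
    rewrite -sum_primes_in -/Q -sum1_size natr_sum mulr_suml big_seq [leRHS]big_seq.
    apply: ler_sum => q; rewrite mem_primes_in ?(ltW z0) ?(le_trans ler01 z21) // => /and3P[pq q1 q2].
    have q0 : (0 : R) < q%:R by rewrite ltr0n prime_gt0.
    rewrite mul1r -mulrA; apply: ler_pM; rewrite ?invr_ge0 ?ln_nat_ge0 //; first by rewrite ler_ln.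
    rewrite -[leRHS]invf_div lef_pV2 ?posrE ?divr_gt0 //.
    by rewrite -expRN ltW.
  move=> h2; have := le_trans h1 h2; rewrite mulrA ler_pdivlMr // mul1r.
  by rewrite [expR 21 * _]mulrC.
have := @prime_products_sum R (fun _ => 1) Q T (primes_in_uniq _ _) (primes_in_prime _ _) (erefl _) (fun _ => ler01) (fun _ _ _ _ => esym (mulr1 1)).
have sz (u : seq nat) : \sum_(q <- u) (1 : R) = (size u)%:R.
  by rewrite big_const_seq count_predT iter_addr_0.
rewrite !sz => h.
have f0 : (0 : R) < T`!%:R by rewrite ltr0n fact_gt0.
rewrite -(ler_pM2l f0); apply: le_trans h.
have -> : expR (- (T%:R * (21 + ln (ln z) + ln T%:R))) = (expR 21 * ln z) ^- T * (T%:R ^+ T)^-1.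
  rewrite expRN -invfM; congr (_^-1).
  by rewrite expRM_natl !expRD !lnK ?posrE // exprMn.
have -> : T`!%:R * (z ^+ T * ((expR 21 * ln z) ^- T * (T%:R ^+ T)^-1)) =
   (z / (expR 21 * ln z)) ^+ T * (T`!%:R / T%:R ^+ T) :> R.
  by rewrite expr_div_n; ring.
have D0 : 0 < z / (expR 21 * ln z) by rewrite divr_gt0 ?mulr_gt0.
apply: (@le_trans _ _ ((z / (expR 21 * ln z)) ^+ T)).
  rewrite ler_piMr ?exprn_ge0 ?(ltW D0) // ler_pdivrMr ?exprn_gt0 // mul1r.
  rewrite -natrX ler_nat.
  exact: fact_le_expn.
by rewrite lerXn2r ?nnegrE ?(ltW D0).
Qed.

(** The triple (p, m, r) can be recovered from n = p^2 m r because the sizes of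
    the primes of r, of m, and p lie in disjoint ranges; the largest prime factor
    of n is p and its square divides n but not p!. *)
Lemma N_count_ge (Qp s : seq nat) (F : nat -> nat -> seq nat) (y1 y x : R) :
  y1 <= y -> uniq Qp -> (forall p, p \in Qp -> prime p /\ y < p%:R) ->
  uniq s -> (forall m, m \in s -> prime_supp (fun p => (y1 < p%:R) && (p%:R <= y)) m) ->
  (forall p m, p \in Qp -> m \in s -> uniq (F p m)) ->
  (forall p m r, p \in Qp -> m \in s -> r \in F p m ->
      prime_supp (fun p => p%:R <= y1) r /\ (p ^ 2 * (m * r))%:R <= x) ->
  \sum_(p <- Qp) \sum_(m <- s) ((size (F p m))%:R : R) <= (N x)%:R.
Proof.
move=> y1y uQ hQ us hs uF hF.
pose f (u : nat * nat) r : nat := (u.1 ^ 2 * (u.2 * r))%N.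
pose l := [seq f u r | u <- [seq (p, m) | p <- Qp, m <- s], r <- F u.1 u.2].
have -> : \sum_(p <- Qp) \sum_(m <- s) ((size (F p m))%:R : R) = (size l)%:R.
  rewrite /l size_allpairs_dep sumnE big_map big_allpairs_dep natr_sum.
  by apply: eq_bigr => p _; rewrite natr_sum.
have pair u : u \in [seq (p, m) | p <- Qp, m <- s] -> u.1 \in Qp /\ u.2 \in s.
  by move=> /allpairsP[[p m] /= [pQ ms ->]].
rewrite ler_nat /N -size_filter; apply: uniq_leq_size.
  apply: allpairs_uniq_dep.
  - by apply: allpairs_uniq => // -[p m] [p' m'].
  - by move=> u /pair[pQ ms]; apply: uF.
  move=> v v' /allpairsPdep[u [r [/pair[pQ ms] rF ->]]] /allpairsPdep[u' [r' [/pair[pQ' ms'] rF' ->]]] /=.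
  case: u pQ ms rF => p m /= pQ ms rF; case: u' pQ' ms' rF' => p' m' /= pQ' ms' rF'.
  rewrite /f /= mulnC [RHS]mulnC => e.
  have big q : q \in Qp -> prime_supp (predC (fun p => p%:R <= y)) (q ^ 2).
    move=> /hQ[pq qy]; split; first by rewrite expn_gt0 prime_gt0.
    by move=> q' pq'; rewrite Euclid_dvdX // andbT dvdn_prime2 // => /eqP -> /=; rewrite -ltNge.
  have small q k c : q \in Qp -> k \in s -> c \in F q k -> prime_supp (fun p => p%:R <= y) (k * c).
    move=> qQ ks cF; apply: prime_suppM; first by apply: prime_supp_sub (hs _ ks) => ? _ /andP[].
    by have [+ _] := hF _ _ _ qQ ks cF; apply: prime_supp_sub => ? _ /le_trans; apply.
  have [e1 e2] := prime_supp_split (small _ _ _ pQ ms rF) (small _ _ _ pQ' ms' rF') (big _ pQ) (big _ pQ') e.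
  have ep : p = p' by apply/eqP; rewrite -(@eqn_exp2r _ _ 2) // e2.
  have low q k c : q \in Qp -> k \in s -> c \in F q k -> prime_supp (predC (fun p => y1 < p%:R)) c.
    move=> qQ ks cF; have [+ _] := hF _ _ _ qQ ks cF; apply: prime_supp_sub => ? _ /=.
    by rewrite leNgt.
  have hi k : k \in s -> prime_supp (fun p => y1 < p%:R) k.
    by move=> /hs; apply: prime_supp_sub => ? _ /andP[].
  have [-> ->] := prime_supp_split (hi _ ms) (hi _ ms') (low _ _ _ pQ ms rF) (low _ _ _ pQ' ms' rF') e1.
  by rewrite ep.
move=> n /allpairsPdep[u [r [/pair[pQ ms] rF ->]]]; move: u pQ ms rF => [p m] /= pQ ms rF.
have [pp yp] := hQ _ pQ; have [rs nx] := hF _ _ _ pQ ms rF.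
rewrite /f /=; set n' := (p ^ 2 * (m * r))%N in nx *.
have [m0 hm] := hs _ ms; have [r0 hr] := rs.
have n0 : (0 < n')%N by rewrite /n' muln_gt0 expn_gt0 (prime_gt0 pp) muln_gt0 m0 r0.
have p2n : (p ^ 2 %| n')%N by rewrite dvdn_mulr.
have pn : (p %| n')%N by apply: dvdn_trans p2n; rewrite dvdn_mull.
have n1 : (1 < n')%N by apply: leq_trans (dvdn_leq n0 pn); apply: prime_gt1.
have x0 : 0 <= x by apply: le_trans nx.
rewrite mem_filter mem_index_iota n1 ltnS truncn_ge_nat // nx !andbT.
have -> : max_pdiv n' = p.
  apply/eqP; rewrite eqn_leq max_pdiv_max ?mem_primes ?pp ?n0 // andbT.
  have := max_pdiv_prime n1; have := max_pdiv_dvd n'; move: (max_pdiv n') => q qn pq.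
  move: qn; rewrite /n' Euclid_dvdM // Euclid_dvdX // andbT dvdn_prime2 // => /orP[/eqP -> //|].
  rewrite Euclid_dvdM // => qd; rewrite -(ler_nat R) ltW //; apply: le_lt_trans yp.
  case/orP: qd => [/(hm _ pq)/andP[] //|/(hr _ pq)/le_trans]; exact.
apply/negP => /(dvdn_trans p2n); case: (p) pp => // k pk; rewrite factS expnS expn1 dvdn_pmul2l //.
by apply/negP; apply: prime_ndvd_fact.
Qed.
End Construction.

(** * The lower bound *)

Lemma half_bounds (J : nat) : (J./2 <= J)%N /\ (J <= 2 * J./2 + 1)%N.
Proof. by lia. Qed.

Lemma top_half (J j : nat) : (J - J./2 <= j)%N -> (J <= 2 * j.+1)%N.
Proof. by lia. Qed.

Lemma top_half2 (J : nat) : (J <= 2 * (J - J./2))%N.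
Proof. by lia. Qed.

Section BlockChoice.
Variable R : realType.
Implicit Types (a b x y z t th : R) (p q i J : nat).

Lemma sum_top J n (F : nat -> R) : (n <= J)%N ->
  \sum_(J - n <= j < J) F j.+1 = \sum_(0 <= i < n) F (J - i)%N.
Proof.
elim: n => [|n IH] nJ; first by rewrite subn0 !big_geq.
rewrite big_ltn; last by lia.
have -> : ((J - n.+1).+1 = J - n)%N by lia.
by rewrite IH 1?ltnW // big_nat_recr //= addrC.
Qed.

Lemma large_facts t J : large t -> t ^+ 5 <= J%:R -> J%:R <= t ^+ 5 + 1 ->
  [/\ J%:R^-1 <= t^-1 ^+ 5, t / J%:R <= t^-1 ^+ 4, J%:R <= 2 * t ^+ 5 &
   forall m, (m < 20)%N -> 100 * t ^+ m <= expR t].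
Proof.
move=> lt J1 J2; have [t1 _] := lt; have t0 : 0 < t by lra.
have t50 : 0 < t ^+ 5 by rewrite exprn_gt0.
have J0' : (0 : R) < J%:R by apply: lt_le_trans J1.
have iJ : J%:R^-1 <= t^-1 ^+ 5 by rewrite exprVn lef_pV2 // posrE.
split=> //.
- have -> : t^-1 ^+ 4 = t * t^-1 ^+ 5 by field; rewrite gt_eqF.
  by rewrite ler_wpM2l // ltW.
- have : 1 <= t ^+ 5 by rewrite exprn_ege1 //; lra.
  lra.
move=> m m20; apply: le_trans (large_expR lt); apply: le_trans (exprS_le t1 (ltnW m20)).
by rewrite ler_wpM2r ?exprn_ge0 ?(ltW t0) // -[leLHS]expr1 ler_eXn2l ?subn_gt0 //; lra.
Qed.

Lemma geo_main_ge (t w rho iJ : R) : 0 < t -> w = t^-1 -> w <= 1 / 100 ->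
  0 <= rho -> rho <= w ^+ 5 -> 0 <= iJ -> iJ <= w ^+ 5 ->
  w + w ^+ 2 - 3 * w ^+ 5 <= (1 - rho) / t + ((1 - rho) / t - iJ - rho) / t.
Proof.
move=> t0 wE w1 r0 r1 i0 i1; have w0 : 0 < w by rewrite wE invr_gt0.
have [[w20 W2] _ _ [w50 _]] := small_powers w0 w1.
have -> : (1 - rho) / t + ((1 - rho) / t - iJ - rho) / t =
   w + w ^+ 2 - rho * w - rho * w ^+ 2 - iJ * w - rho * w by rewrite wE; field; rewrite !gt_eqF.
have : rho * w <= w ^+ 5 / 2 by clear -r0 r1 w0 w1; nra.
have : rho * w ^+ 2 <= w ^+ 5.
  by rewrite -[leRHS]mulr1; apply: ler_pM => //; clear -w20 W2 w1; lra.
have : iJ * w <= w ^+ 5.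
  by rewrite -[leRHS]mulr1; apply: ler_pM => //; clear -w0 w1; lra.
clear; lra.
Qed.

Lemma block_total_ge (w E th K Sc Jr : R) : 0 < w -> w <= 1 / 100 -> 0 < E ->
  0 < th -> th <= w ^+ 4 -> Jr <= E * w ^+ 4 / 10 ->
  E * (w + w ^+ 2 - 3 * w ^+ 5) <= Sc -> (1 - 3 * th) * Sc - Jr <= K ->
  E * (w + w ^+ 2 - w ^+ 3 / 2) <= K.
Proof.
move=> w0 w1 E0 th0 th1 JE hSc; apply: le_trans.
have [[w20 W2] [w30 W3] [w40 W4] [w50 W5]] := small_powers w0 w1.
have : (1 - 3 * th) * (E * (w + w ^+ 2 - 3 * w ^+ 5)) <= (1 - 3 * th) * Sc.
  by rewrite ler_wpM2l //; clear -th1 W2 W3 W4 w1; lra.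
have : th * (E * (w + w ^+ 2 - 3 * w ^+ 5)) <= w ^+ 4 * (E * 1).
  apply: ler_pM => //; rewrite ?(ltW th0) //.
    by rewrite mulr_ge0 ?(ltW E0) //; clear -W2 W3 W4 W5 w0 w20; lra.
  by rewrite ler_wpM2l ?(ltW E0) //; clear -W2 w50 w1; lra.
have : E * w ^+ 5 <= E * (w ^+ 4 / 100) by rewrite ler_wpM2l // ltW.
have : E * w ^+ 4 <= E * (w ^+ 3 / 100) by rewrite ler_wpM2l // ltW.
have : 0 < E * w ^+ 3 by rewrite mulr_gt0.
clear -JE; lra.
Qed.

(** The number k_j of primes from the j-th block is the expected number under the
    weights q^(- 1 + t/E). Then V, which is t/E times the logarithm of the product,
    is close to E, K is the main term exp t (1/t + 1/t^2), and by Stirling's formula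
    the sum of 1/m is at least exp (K - V) up to negligible factors. The factor
    1 - 3 th leaves room for p^2 and r below x. *)
Lemma block_choice t J : large t -> t ^+ 5 <= J%:R -> J%:R <= t ^+ 5 + 1 ->
  let E := expR t in let W := E / J%:R in let th := t / J%:R in
  let a := (J - J./2)%N in
  exists k : nat -> nat,
   let V := th * \sum_(a <= j < J) (k j)%:R * j.+1%:R in
   let K := \sum_(a <= j < J) (k j)%:R in
   [/\ V <= (1 - 2 * th) * E, (1 - 4 * th) * E <= V,
     K <= 2 * E / t, E * (t^-1 + t^-1 ^+ 2 - t^-1 ^+ 3 / 2) <= K &
     expR (K - V - 40 * K / W - J%:R * (1 + t)) <=
       \prod_(a <= j < J) (prime_sum (expR (W * j%:R)) (expR (W * j.+1%:R)) (fun q => q%:R^-1) ^+ k j / (k j)`!%:R)].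
Proof.
move=> lt J1 J2 E W th a; have [t1 X1] := lt.
have [iJ thle J3 EP] := large_facts lt J1 J2.
have t0 : 0 < t by lra.
have E0 : 0 < E by exact: expR_gt0.
have t50 : 0 < t ^+ 5 by rewrite exprn_gt0.
have J0' : (0 : R) < J%:R by apply: lt_le_trans J1.
have J0 : (0 < J)%N by rewrite -(ltr0n R).
have th0 : 0 < th by rewrite divr_gt0.
have thJ : th * J%:R = t by rewrite /th divfK // gt_eqF.
set w := t^-1 in iJ thle *; rewrite -/th in thle; rewrite -/E in EP.
have o0 : 0 < w by rewrite invr_gt0.
have o1 : w <= 1 / 100 by rewrite /w -[_^-1]div1r ler_pdivrMr //; lra.
have ot : w * t = 1 by rewrite mulVf // gt_eqF.
have Wo (m : nat) : 0 < w ^+ m by rewrite exprn_gt0.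
have [[_ W2] [_ W3] [_ W4] [_ W5]] := small_powers o0 o1.
have th1 : th <= 1 / 100.
  by move: thle (Wo 4%N) W4 W3 W2; lra.
have [th3 th3'] : 0 <= 1 - 3 * th /\ 1 - 3 * th <= 1 by split; lra.
set n := J./2.
have [nJ nJ2'] := half_bounds J; rewrite -/n in nJ nJ2'.
have nJ2 : (J%:R <= 2 * n%:R + 1 :> R).
  by rewrite -[2]/(2%:R) -natrM natr1 ler_nat -addn1.
set r := expR (- th).
have rn : r ^+ n <= w ^+ 20.
  rewrite geo_ratioX exprVn expRN lef_pV2 ?posrE ?expR_gt0 ?exprn_gt0 //.
  apply: le_trans X1 _; rewrite ler_expR.
  have : th * J%:R <= th * (2 * n%:R + 1) by rewrite ler_wpM2l // ltW.
  rewrite thJ; lra.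
have rn0 : 0 <= r ^+ n by rewrite exprn_ge0 // expR_ge0.
have o20 : w ^+ 20 <= w ^+ 5 / 2 * w.
  have -> : w ^+ 20 = w ^+ 6 * w ^+ 14 by rewrite -exprD.
  have -> : w ^+ 5 / 2 * w = w ^+ 6 * (1 / 2) by rewrite [w ^+ 6]exprSr; ring.
  apply: ler_wpM2l; first exact: ltW.
  apply: (@le_trans _ _ w); last lra.
  by rewrite -[leRHS]expr1 ler_wiXn2l //; lra.
pose c j := expR (th * j%:R) / j%:R.
(* The index j stands for the block (exp (W j), exp (W (j+1))], hence the shifts j.+1. *)
pose k j := Num.truncn ((1 - 3 * th) * c j.+1).
have c0 j : 0 <= c j by rewrite divr_ge0 ?expR_ge0.
have kc0 j : 0 <= (1 - 3 * th) * c j.+1 by rewrite mulr_ge0.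
have k1 j : (k j)%:R <= (1 - 3 * th) * c j.+1.
  by have /andP[] := truncn_itv (kc0 j).
have k2 j : (1 - 3 * th) * c j.+1 - 1 <= (k j)%:R.
  by have /andP[_] := truncn_itv (kc0 j); rewrite -/(k j) -natr1; lra.
have cj j : c j.+1 * j.+1%:R = expR (th * j.+1%:R) by rewrite /c divfK // gt_eqF.
have Sexp : \sum_(a <= j < J) expR (th * j.+1%:R) = E * \sum_(0 <= i < n) r ^+ i.
  rewrite (@sum_top J n (fun j => expR (th * j%:R))) // mulr_sumr.
  by apply: eq_big_nat => i /andP[_ ni]; rewrite expR_sub_geo ?thJ // ltnW // (leq_trans ni nJ).
exists k => V K.
have sJ : \sum_(a <= j < J) (j.+1%:R : R) <= J%:R * J%:R.
  apply: (@le_trans _ _ (\sum_(a <= j < J) (J%:R : R))).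
    by apply: ler_sum_nat => j /andP[_ jJ]; rewrite ler_nat.
  rewrite sumr_const_nat -[_ *+ (J - a)]mulr_natl ler_wpM2r // ler_nat; exact: leq_subr.
have V1 : V <= (1 - 2 * th) * E.
  have : \sum_(a <= j < J) (k j)%:R * j.+1%:R <= (1 - 3 * th) * (E * \sum_(0 <= i < n) r ^+ i).
    rewrite -Sexp mulr_sumr; apply: ler_sum => j _; rewrite -cj mulrA.
    by rewrite ler_wpM2r.
  have := geo0_le th0 n; rewrite -/r.
  set S := \sum_(_ <= _ < _) r ^+ _; set Q := \sum_(_ <= _ < _) _ * _ => hS hQ.
  have hES : E * S <= E * (1 / th + 1) by rewrite ler_wpM2l // ltW.
  have : (1 - 3 * th) * (E * S) <= (1 - 3 * th) * (E * (1 / th + 1)) by rewrite ler_wpM2l.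
  move=> h; have := ler_wpM2l (ltW th0) (le_trans hQ h).
  have -> : th * ((1 - 3 * th) * (E * (1 / th + 1))) = (1 - 3 * th) * (1 + th) * E.
    by field; rewrite gt_eqF.
  rewrite -/V => /le_trans; apply; rewrite ler_wpM2r ?(ltW E0) //.
  have : 0 <= th ^+ 2 by rewrite sqr_ge0.
  lra.
have Jsq : 2 * J%:R * J%:R <= E.
  have h := EP 10 isT.
  have : J%:R * J%:R <= (2 * t ^+ 5) * (2 * t ^+ 5) by apply: ler_pM.
  have -> : (2 * t ^+ 5) * (2 * t ^+ 5) = 4 * t ^+ 10 by ring.
  have : 0 <= t ^+ 10 by rewrite exprn_ge0 // ltW.
  lra.
have tJE : t * J%:R <= th * E / 2.
  rewrite ler_pdivlMr // /th [leRHS]mulrAC ler_pdivlMr //.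
  have -> : t * J%:R * 2 * J%:R = t * (2 * J%:R * J%:R) by ring.
  by rewrite ler_wpM2l // ltW.
have rth : r ^+ n <= th / 2.
  apply: le_trans rn _; apply: le_trans o20 _.
  have oth : w ^+ 4 / 2 <= th.
    rewrite /th ler_pdivlMr //.
    have -> : t = w ^+ 4 / 2 * (2 * t ^+ 5) by rewrite /w; field; rewrite gt_eqF.
    by rewrite ler_wpM2l // divr_ge0 // ltW.
  have : w ^+ 5 / 2 * w <= w ^+ 5 / 2 by rewrite ler_piMr ?divr_ge0 ?(ltW (Wo 5%N)) //; lra.
  move: (Wo 5%N); lra.
have V2 : (1 - 4 * th) * E <= V.
  have : (1 - 3 * th) * (E * \sum_(0 <= i < n) r ^+ i) - J%:R * J%:R <=
     \sum_(a <= j < J) (k j)%:R * j.+1%:R.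
    apply: le_trans (lerB (lexx _) sJ) _; rewrite -Sexp mulr_sumr -sumrB.
    apply: ler_sum => j _; rewrite -cj mulrA -[X in _ - X]mul1r -mulrBl.
    by rewrite ler_wpM2r.
  have := geo0_ge th0 n; rewrite -/r.
  set S := \sum_(_ <= _ < _) r ^+ _; set Q := \sum_(_ <= _ < _) _ * _ => hS hQ.
  have hES : E * ((1 - r ^+ n) / th) <= E * S by rewrite ler_wpM2l // ltW.
  have : (1 - 3 * th) * (E * ((1 - r ^+ n) / th)) <= (1 - 3 * th) * (E * S) by rewrite ler_wpM2l.
  move=> h; have := ler_wpM2l (ltW th0) (le_trans (lerB h (lexx _)) hQ).
  have -> : th * ((1 - 3 * th) * (E * ((1 - r ^+ n) / th)) - J%:R * J%:R) =
     (1 - 3 * th) * (1 - r ^+ n) * E - t * J%:R.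
    by rewrite -thJ; field; rewrite gt_eqF.
  rewrite -/V; apply: le_trans.
  have : (1 - 3 * th) * (1 - th / 2) * E <= (1 - 3 * th) * (1 - r ^+ n) * E.
    by rewrite ler_wpM2r ?(ltW E0) // ler_wpM2l // lerD2l lerN2.
  have : 0 <= th ^+ 2 * E by rewrite mulr_ge0 ?sqr_ge0 // ltW.
  lra.
have K1 : K <= 2 * E / t.
  apply: (@le_trans _ _ (2 / J%:R * \sum_(a <= j < J) (k j)%:R * j.+1%:R)).
    rewrite mulr_sumr; apply: ler_sum_nat => j /andP[ja _].
    rewrite [(k j)%:R * _]mulrC mulrA ler_peMl // mulrAC ler_pdivlMr // mul1r.
    by rewrite -[2]/(2%:R) -natrM ler_nat; exact: top_half ja.
  have -> : 2 / J%:R * \sum_(a <= j < J) (k j)%:R * j.+1%:R = 2 * V / t.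
    by rewrite /V /th; field; rewrite !gt_eqF.
  rewrite ler_wpM2r ?invr_ge0 ?(ltW t0) // ler_wpM2l //; apply: le_trans V1 _.
  by rewrite ler_piMl ?ltW //; lra.
have JE4 : J%:R <= E * w ^+ 4 / 10.
  have h := EP 9 isT; apply: le_trans J3 _.
  rewrite /w exprVn ler_pdivlMr // ler_pdivlMr ?exprn_gt0 //.
  have -> : 2 * t ^+ 5 * 10 * t ^+ 4 = 20 * t ^+ 9 by ring.
  have : 0 <= t ^+ 9 by rewrite exprn_ge0 // ltW.
  lra.
have K2 : E * (w + w ^+ 2 - w ^+ 3 / 2) <= K.
  have := @exp_sum_ge _ th th0 J n t J0 nJ (esym thJ); rewrite -/r -/E -/w => h1.
  have h2 : (1 - 3 * th) * \sum_(0 <= i < n) c (J - i)%N - J%:R <= K.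
    rewrite -(@sum_top J n c) // mulr_sumr.
    have -> : (J%:R : R) = \sum_(0 <= j < J) 1 by rewrite sumr_const_nat subn0.
    rewrite (@big_cat_nat _ _ _ a 0 J) //= ?leq_subr //.
    rewrite opprD addrCA; apply: (@le_trans _ _ (\sum_(a <= j < J) (1 - 3 * th) * c j.+1 - \sum_(a <= j < J) 1)).
      by rewrite gerDr oppr_le0 sumr_ge0.
    by rewrite -sumrB; apply: ler_sum.
  apply: le_trans h2; set Sc := \sum_(_ <= _ < _) _.
  have hSc : E * (w + w ^+ 2 - 3 * w ^+ 5) <= Sc.
    apply: le_trans h1; rewrite ler_wpM2l ?(ltW E0) //.
    have r5 : r ^+ n <= w ^+ 5 by move: (Wo 5%N) rn o20 o1; clear; nra.
    by apply: geo_main_ge => //; rewrite invr_ge0.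
  exact: (block_total_ge o0 o1 E0 th0 thle JE4 hSc (lexx _)).
split=> //.
have W0 : 0 < W by rewrite divr_gt0.
have W40 : 40 <= W.
  by rewrite ler_pdivlMr //; have h := EP 5%N isT; lra.
pose al j := th * j.+1%:R + 40 / W.
apply: (@le_trans _ _ (\prod_(a <= j < J) expR ((k j)%:R - (k j)%:R * al j - 1 - ln (expR t)))).
  rewrite -expR_sum ler_expR expRK.
  have -> : \sum_(a <= j < J) ((k j)%:R - (k j)%:R * al j - 1 - t) =
     K - V - 40 * K / W - \sum_(a <= j < J) (1 + t).
    rewrite /K /V mulr_sumr mulr_sumr mulr_suml -!sumrB; apply: eq_bigr => j _.
    by rewrite /al; ring.
  rewrite lerD2l lerN2 sumr_const_nat -[_ *+ (J - a)]mulr_natl ler_wpM2r ?ler_nat ?leq_subr //.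
  by rewrite addr_ge0 // ltW.
rewrite big_nat_cond [leRHS]big_nat_cond; apply: ler_prod => j /andP[/andP[_ jJ] _]; rewrite expR_ge0 /=.
have j0 : (0 : R) < j.+1%:R by rewrite ltr0n.
have j1 : (1 : R) <= j.+1%:R by rewrite ler1n.
have jJ' : th * j.+1%:R <= t by rewrite -thJ ler_wpM2l ?(ltW th0) // ler_nat.
apply: powX_div_fact_ge.
- by apply: sumr_ge0 => q _; rewrite invr_ge0.
- by rewrite -[leLHS]expR0 ler_expR ltW.
- apply: le_trans (k1 j) _; apply: (@le_trans _ _ (c j.+1)).
    by rewrite ler_piMl.
  rewrite /c ler_pdivrMr //; apply: (@le_trans _ _ (expR t)); first by rewrite ler_expR.
  by rewrite ler_peMr // expR_ge0.
apply: le_trans (prime_sum_inv_block_ge j W0).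
apply: (@le_trans _ _ (c j.+1 * expR (- al j))).
  rewrite ler_wpM2r ?expR_ge0 //; apply: le_trans (k1 j) _.
  by rewrite ler_piMl.
have -> : c j.+1 * expR (- al j) = expR (- (40 / W)) / j.+1%:R.
  by rewrite /c /al opprD expRD !expRN; field; rewrite !gt_eqF ?expR_gt0.
have -> : (W - 20) / (W * j.+1%:R) = (1 - 20 / W) / j.+1%:R by field; rewrite !gt_eqF.
rewrite ler_wpM2r ?invr_ge0 // expRN.
have hx := expR_ge1Dx (40 / W); rewrite -[leLHS]div1r ler_pdivrMr ?expR_gt0 //; move: hx.
have -> : 40 / W = 2 * (20 / W) by ring.
have : 20 / W <= 1 / 2 by rewrite ler_pdivrMr //; clear -W40; lra.
have : 0 < 20 / W by rewrite divr_gt0.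
move: (20 / W) (expR _) => u v u0 u1 uv; clear -u0 u1 uv; nra.
Qed.
End BlockChoice.

Section LowerBound.
Variable R : realType.
Implicit Types (a b x y z t th : R) (p q i J : nat).

(** Here lx, lp and lm are the logarithms of x, p and m. The room left by m is of
    order th * lx, which exceeds 2 lp; so r takes a positive but small part of the
    logarithmic size of n, and its choice costs little. *)
Lemma fill_bounds (t E W th V K lx lp lm : R) (J : nat) :
  100 <= t -> 0 < E -> 42 <= E -> 3 <= W -> E * th = t * W -> lx = E ^+ 2 / t ->
  V <= (1 - 2 * th) * E -> (1 - 4 * th) * E <= V -> K <= 2 * E / t ->
  E <= lp -> lp <= E + 21 -> E / t * V - W * K <= lm -> lm <= E / t * V ->
  W * E <= lx - 2 * lp - lm /\ lx - 2 * lp - lm <= 5 * W * E.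
Proof.
move=> t1 E0 E42 W3 EW lxE V1 V2 K1 p1 p2 m1 m2.
have t0 : 0 < t by lra.
have Et : 0 <= E / t by rewrite divr_ge0 // ltW.
have h1 := ler_wpM2l Et V1; have h2 := ler_wpM2l Et V2.
have e1 : E / t * ((1 - 2 * th) * E) = lx - 2 * (W * E).
  by rewrite lxE; have -> : E / t * ((1 - 2 * th) * E) = E ^+ 2 / t - 2 * (E * th) * E / t;
   [ring | rewrite EW; field; rewrite gt_eqF].
have e2 : E / t * ((1 - 4 * th) * E) = lx - 4 * (W * E).
  by rewrite lxE; have -> : E / t * ((1 - 4 * th) * E) = E ^+ 2 / t - 4 * (E * th) * E / t;
   [ring | rewrite EW; field; rewrite gt_eqF].
rewrite e1 in h1; rewrite e2 in h2.
have W0 : 0 <= W by lra.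
have h3 := ler_wpM2l W0 K1.
have h4 : W * (2 * E / t) <= W * E.
  rewrite ler_wpM2l // ler_pdivrMr //; nra.
have h5 : 3 * E <= W * E by rewrite ler_wpM2r // ltW.
split; lra.
Qed.

(** With p just above exp E and m from the previous lemma, r runs over the
    products of T primes up to z, where z^T = x/(p^2 m). Their number is
    x/(p^2 m) up to a factor exp (48 t E/J), so the count is at least
    x times the sum of 1/p^2, about exp (- E), times the sum of 1/m, about
    exp (K - E). *)
Lemma N_lower t x : large t -> 0 < x -> ln x = expR t ^+ 2 / t ->
  x * expR (- (2 * expR t) + expR t * (t^-1 + t^-1 ^+ 2 - 2 * t^-1 ^+ 3)) <= (N x)%:R.
Proof.
move=> lt x0 lx; have [t1 X1] := lt.
have t0 : 0 < t by lra.
have t50 : 0 < t ^+ 5 by rewrite exprn_gt0.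
pose J := (Num.truncn (t ^+ 5)).+1.
have J1 : t ^+ 5 <= J%:R by rewrite ltW // truncnS_gt.
have J2 : J%:R <= t ^+ 5 + 1.
  by rewrite -natr1 lerD2r; have /andP[] := truncn_itv (ltW t50).
move: J J1 J2 => J J1 J2.
have [iJ thle J3 EP] := large_facts lt J1 J2.
have [k [V1 V2 K1 K2 P1]] := block_choice lt J1 J2.
set E := expR t in lx EP V1 V2 K1 K2 P1 *; set W := E / J%:R in V1 V2 K1 K2 P1; set th := t / J%:R in thle V1 V2 K1 K2 P1.
set a := (J - J./2)%N in V1 V2 K1 K2 P1.
set V := th * _ in V1 V2 P1; set K := \sum_(_ <= _ < _) _ in K1 K2 P1.
have E0 : 0 < E by exact: expR_gt0.
have J0' : (0 : R) < J%:R by apply: lt_le_trans J1.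
have J0 : (0 < J)%N by rewrite -(ltr0n R).
have th0 : 0 < th by rewrite divr_gt0.
have W0 : 0 < W by rewrite divr_gt0.
have WJ : W * J%:R = E by rewrite /W divfK // gt_eqF.
have EW : E * th = t * W by rewrite /W /th; ring.
have t5 : 1 <= t ^+ 5 by rewrite exprn_ege1 //; lra.
have E42 : 42 <= E.
  have := EP 5%N isT; clear -t5; lra.
have E16 : 21 <= E / 16 by have := EP 1%N isT; rewrite expr1; clear -t1; lra.
have W3 : 3 <= W.
  by rewrite ler_pdivlMr //; have h := EP 5%N isT; clear -h J3 t5; lra.
have E1 : 1 <= E by clear -E42; lra.
have J16 : 16 <= J%:R :> R.
  apply: le_trans J1; apply: (@le_trans _ _ t); first by clear -t1; lra.
  by rewrite -[leLHS]expr1 ler_weXn2l //; clear -t1; lra.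
pose h j : R := expR (W * j%:R).
have h0 j : 0 <= h j by exact: expR_ge0.
have hS j : h j <= h j.+1 by rewrite ler_expR ler_wpM2l ?(ltW W0) // ler_nat.
have aJ : (a <= J)%N by exact: leq_subr.
have [s [us ss sb sS]] := block_products k h0 hS aJ.
have lm m : m \in s -> E / t * V - W * K <= ln (m%:R : R) /\ ln (m%:R : R) <= E / t * V.
  move=> ms; have [m0 _] := ss _ ms; have /andP[m1 m2] := sb _ ms.
  have m0' : (0 : R) < m%:R by rewrite ltr0n.
  have pr (f : nat -> nat) : \prod_(a <= j < J) h (f j) ^+ k j = expR (\sum_(a <= j < J) (k j)%:R * (W * (f j)%:R)).
    by rewrite expR_sum; apply: eq_bigr => j _; rewrite expRM_natl.
  have -> : E / t * V = \sum_(a <= j < J) (k j)%:R * (W * j.+1%:R).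
    rewrite /V mulrA mulr_sumr; apply: eq_bigr => j _.
    by rewrite /th /W; field; rewrite !gt_eqF.
  rewrite (pr (fun j => j)) in m1; rewrite (pr (fun j => j.+1)) in m2.
  split; last by rewrite -ler_expR lnK.
  rewrite -ler_expR lnK ?posrE //; apply: le_trans m1; rewrite ler_expR /K mulr_sumr -sumrB.
  rewrite le_eqVlt; apply/orP; left; apply/eqP; apply: eq_bigr => j _.
  by rewrite -[j.+1%:R]natr1; ring.
set Qp := primes_in (expR E) (expR (E + 21)).
have Qpp p : p \in Qp -> [/\ prime p, expR E < p%:R & p%:R <= expR (E + 21)].
  by rewrite mem_primes_in ?expR_ge0 // => /and3P.
(* As x/(p^2 m) <= exp (5 W E), this makes z at most exp (E/3), which is below
   all the blocks in use; T is still small enough for T! to be negligible. *)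
pose T := (Num.truncn (15 * W)).+1.
have T1 : 15 * W <= T%:R by rewrite ltW // truncnS_gt.
have T2 : T%:R <= 16 * W.
  have w15 : 0 <= 15 * W by rewrite mulr_ge0 // ltW.
  rewrite -[T%:R]natr1; have /andP[hT _] := truncn_itv w15; clear -hT W3; lra.
have T0 : (0 : R) < T%:R by rewrite ltr0n.
pose lX p m : R := ln x - 2 * ln p%:R - ln m%:R.
have lXb p m : p \in Qp -> m \in s -> W * E <= lX p m /\ lX p m <= 5 * W * E.
  move=> /Qpp[pp p1 p2] /lm[m1 m2]; have p0 : (0 : R) < p%:R by rewrite ltr0n prime_gt0.
  apply: (@fill_bounds t E W th V K) => //.
    by rewrite -ler_expR lnK // ltW.
  by rewrite -ler_expR lnK.
pose z p m : R := expR (lX p m / T%:R).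
pose F p m := prime_products (primes_in (z p m * expR (- 21)) (z p m)) T.
have lz p m : p \in Qp -> m \in s -> E / 16 <= lX p m / T%:R /\ lX p m / T%:R <= E / 3.
  move=> pQ ms; have [l1 l2] := lXb _ _ pQ ms; split.
    rewrite ler_pdivlMr //; apply: le_trans l1.
    have -> : W * E = E / 16 * (16 * W) by field.
    by rewrite ler_wpM2l // divr_ge0 // ltW.
  rewrite ler_pdivrMr //; apply: le_trans l2 _.
  have -> : 5 * W * E = E / 3 * (15 * W) by field.
  by rewrite ler_wpM2l // divr_ge0 // ltW.
have zT p m : p \in Qp -> m \in s -> z p m ^+ T = x * p%:R ^- 2 * m%:R^-1.
  move=> /Qpp[pp _ _] /ss[m0 _].
  have p0 : (0 : R) < p%:R by rewrite ltr0n prime_gt0.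
  have m0' : (0 : R) < m%:R by rewrite ltr0n.
  rewrite /z -expRM_natl mulrC divfK ?gt_eqF // /lX !expRB expRM_natl !lnK //.
have szF p m : p \in Qp -> m \in s ->
    x * p%:R ^- 2 * m%:R^-1 * expR (- (48 * (t * W))) <= (size (F p m))%:R.
  move=> pQ ms; have [l1 l2] := lz _ _ pQ ms.
  have z21 : expR 21 <= z p m by rewrite ler_expR; apply: le_trans l1.
  apply: le_trans (fill_count z21 (ltn0Sn _)); rewrite zT //.
  apply: ler_wpM2l; first by rewrite -zT // exprn_ge0 // expR_ge0.
  rewrite ler_expR lerN2 expRK.
  have lE y : 0 < y -> y <= E -> ln y <= t by move=> y0 yE; rewrite -ler_expR lnK.
  have a1 : ln (lX p m / T%:R) <= t.
    by apply: lE; clear -l1 l2 E0 E16; lra.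
  have a2 : ln (T%:R : R) <= t.
    by apply: lE => //; apply: le_trans T2 _; rewrite -WJ mulrC ler_wpM2l ?(ltW W0).
  have -> : 48 * (t * W) = 16 * W * (3 * t) by ring.
  apply: ler_pM; rewrite ?(ltW T0) //; last by clear -a1 a2 t1; lra.
  have : 0 <= ln (lX p m / T%:R) by rewrite ln_ge0 //; clear -l1 E16; lra.
  have := ln_nat_ge0 R T; clear; lra.
have cnt := @N_count_ge R Qp s F (expR (E / 3)) (expR E) x.
have y1y : expR (E / 3) <= expR E by rewrite ler_expR; clear -E0; lra.
have ha : expR (E / 3) <= h a.
  rewrite /h ler_expR -WJ; have : (J%:R : R) <= 2 * a%:R.
    by rewrite -[2]/(2%:R) -natrM ler_nat top_half2.
  have w0 := W0; have := ler0n R a; clear -w0 => a0 Ja.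
  have : W * J%:R <= W * (2 * a%:R) by rewrite ler_wpM2l // ltW.
  have : 0 <= W * a%:R by rewrite mulr_ge0 // ltW.
  lra.
have hJ : h J = expR E by rewrite /h WJ.
apply: le_trans (cnt y1y (primes_in_uniq _ _) _ us _ _ _); last 4 first.
- by move=> p /Qpp[].
- by move=> m /ss; rewrite hJ; apply: prime_supp_sub => p _ /andP[q1 ->]; rewrite (le_lt_trans ha).
- by move=> p m _ _; exact: prime_products_uniq.
- move=> p m r pQ ms rF; have [l1 l2] := lz _ _ pQ ms.
  have zz : 0 <= z p m * expR (- 21) by rewrite mulr_ge0 ?expR_ge0.
  have z3 : z p m <= expR (E / 3) by rewrite ler_expR.
  split.
    apply: prime_supp_sub (prime_products_supp (primes_in_prime _ _) rF) => q _.
    by rewrite mem_primes_in ?expR_ge0 // => /and3P[_ _ /le_trans]; apply.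
  have Qz q : q \in primes_in (z p m * expR (- 21)) (z p m) -> (0 : R) <= q%:R <= z p m.
    by rewrite mem_primes_in ?expR_ge0 // => /and3P[_ _ ->]; rewrite ler0n.
  have /andP[_] := prime_products_bounds (lexx 0) Qz rF; rewrite zT //.
  have [pp _ _] := Qpp _ pQ; have [m0 _] := ss _ ms.
  have p0 : (0 : R) < p%:R by rewrite ltr0n prime_gt0.
  have m0' : (0 : R) < m%:R by rewrite ltr0n.
  rewrite ler_pdivlMr // ler_pdivlMr ?exprn_gt0 // natrM natrX natrM => hr.
  by have -> : p%:R ^+ 2 * (m%:R * r%:R) = r%:R * m%:R * p%:R ^+ 2 :> R by ring.
apply: (@le_trans _ _ (x * expR (- (48 * (t * W))) * ((\sum_(p <- Qp) p%:R ^- 2) * (\sum_(m <- s) m%:R^-1)))); last first.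
  rewrite mulr_suml mulr_sumr big_seq [leRHS]big_seq; apply: ler_sum => p pQ.
  rewrite !mulr_sumr big_seq [leRHS]big_seq.
  apply: ler_sum => m ms.
  apply: le_trans (szF _ _ pQ ms); rewrite le_eqVlt; apply/orP; left; apply/eqP; ring.
rewrite -mulrA ler_wpM2l ?(ltW x0) //.
have s1 : expR (- E - 21) / (E + 21) <= \sum_(p <- Qp) p%:R ^- 2.
  by rewrite sum_primes_in; apply: prime_inv_sqr_ge.
have s2 := le_trans P1 sS.
have c0 : 0 <= expR (- E - 21) / (E + 21) by rewrite divr_ge0 ?expR_ge0 // addr_ge0 // ltW.
apply: le_trans (ler_wpM2l (expR_ge0 _) (ler_pM c0 (expR_ge0 _) s1 s2)).
have E21 : 0 < E + 21 by rewrite addr_gt0.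
have l21 : ln (E + 21) <= t + 1.
  rewrite -ler_expR lnK // expRD -/E; have := expR_ge1Dx (1 : R).
  have h20 : 42 <= E by []; clear -h20; move: (expR 1) => u u2; nra.
have -> : (E + 21)^-1 = expR (- ln (E + 21)) by rewrite expRN lnK.
rewrite -!expRD ler_expR.
have W1 : 40 * K / W <= 80 * J%:R.
  rewrite ler_pdivrMr //; have -> : 80 * J%:R * W = 80 * E by rewrite -WJ; ring.
  have : 2 * E / t <= 2 * E by rewrite ler_pdivrMr // ler_peMr // ?mulr_ge0 ?(ltW E0) //; clear -t1; lra.
  by move: K1; clear; lra.
have tW : t * W <= E * t^-1 ^+ 4 by rewrite -EW ler_wpM2l // ltW.
have w1 : t^-1 <= 1 / 100 by rewrite -[_^-1]div1r ler_pdivrMr //; clear -t1; lra.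
have w0 : 0 < t^-1 by rewrite invr_gt0.
have w4 : E * t^-1 ^+ 4 <= E * t^-1 ^+ 3 / 100.
  rewrite -mulrA; apply: ler_wpM2l; first exact: ltW.
  rewrite exprSr; apply: ler_wpM2l; first by rewrite exprn_ge0 // ltW.
  by move: w1; clear; lra.
have t6 : t ^+ 6 <= E * t^-1 ^+ 3 / 100.
  have := EP 9 isT; rewrite exprVn ler_pdivlMr // ler_pdivlMr ?exprn_gt0 //.
  have -> : t ^+ 6 * 100 * t ^+ 3 = 100 * t ^+ 9 by ring.
  by [].
have t51 : 100 * t ^+ 5 <= t ^+ 6 by rewrite [t ^+ 6]exprS ler_wpM2r // ltW.
have Jt : J%:R * (1 + t) <= 3 * t ^+ 6.
  apply: (@le_trans _ _ (2 * t ^+ 5 * (1 + t))).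
    by rewrite ler_wpM2r // addr_ge0 // ltW.
  have -> : 2 * t ^+ 5 * (1 + t) = 2 * t ^+ 5 + 2 * t ^+ 6 by ring.
  by clear -t51 t50; lra.
have tt : t <= t ^+ 6 by rewrite -[leLHS]expr1 ler_weXn2l //; clear -t1; lra.
have VE : V <= E.
  by apply: le_trans V1 _; rewrite ler_piMl ?(ltW E0) //; clear -th0; lra.
have xE0 : 0 <= E * t^-1 ^+ 3 by rewrite mulr_ge0 ?exprn_ge0 ?(ltW w0) ?(ltW E0).
move: K2 W1 tW w4 t6 t51 Jt tt VE J3 l21 xE0 t5.
clear; rewrite !mulrDr; lra.
Qed.
End LowerBound.

(** * Expansion at the saddle point *)

Section Expansion.
Variable R : realType.
Implicit Types (a b x y z t th : R) (p q i J : nat).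

(** These rules bound a polynomial expression from bounds on its variables. *)
Lemma normD_le x y a b : `|x| <= a -> `|y| <= b -> `|x + y| <= a + b.
Proof. by move=> h1 h2; apply: le_trans (ler_normD _ _) (lerD h1 h2). Qed.

Lemma normN_le x a : `|x| <= a -> `|- x| <= a.
Proof. by rewrite normrN. Qed.

Lemma normM_le x y a b : `|x| <= a -> `|y| <= b -> `|x * y| <= a * b.
Proof. by move=> h1 h2; rewrite normrM; apply: ler_pM. Qed.

Lemma normX2_le x a : `|x| <= a -> `|x ^+ 2| <= a ^+ 2.
Proof. by move=> h; rewrite normrX lerXn2r // nnegrE (le_trans _ h). Qed.

Lemma norm_pos_le x : 0 <= x -> `|x| <= x.
Proof. by move=> h; rewrite ger0_norm. Qed.

Ltac bound_norm := lazymatch goal with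
  | |- is_true (`|_ + _| <= _) => eapply normD_le; bound_norm
  | |- is_true (`|- _| <= _) => eapply normN_le; bound_norm
  | |- is_true (`|_ * _| <= _) => eapply normM_le; bound_norm
  | |- is_true (`|_ ^+ 2| <= _) => eapply normX2_le; bound_norm
  | |- is_true (`|_ ^-1| <= _) => apply: norm_pos_le; by rewrite invr_ge0 ler0n
  | |- is_true (`|_ *+ _| <= _) => apply: norm_pos_le; by rewrite ler0n
  | |- is_true (`|1| <= _) => apply: norm_pos_le; by rewrite ler01
  | |- _ => eassumption
  end.

(** The difference of the two sides is a polynomial multiple of s^3. Here w = 1/t,
    om = w/s, and be, eta and rho are the remainders of ln (1-s), of (1-s)^(-1/2)
    and of the estimate for N, relative to s^2, s^3 and s^3. The cofactor is found
    by expanding (1-s)^(-1) as 1 + s u and 1 + s + s^2 u. *)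
Lemma expansion_match (s om be eta rho w b u h : R) :
  0 <= s -> s <= 1 / 2 -> 0 <= om -> om <= 1 ->
  `|be| <= 2 -> `|eta| <= 4 -> `|rho| <= 21 ->
  w = s * om -> b = - s + s ^+ 2 * be -> u = (1 - s)^-1 ->
  h = 1 + s / 2 + 3 / 8 * s ^+ 2 + s ^+ 3 * eta ->
  `| (1 - w / 2 - w ^+ 2 / 2 + s ^+ 3 * rho) * h - 1 -
     ((2 * s + b * w - 2 * w) * u / 4 * (1 + w * u) - ((2 * s + b * w) * u) ^+ 2 / 32) |
  <= 500 * s ^+ 3.
Proof.
move=> s0 s1 om0 om1 hbe heta hrho ew eb eu eh; rewrite ew eb eu eh {w b u h ew eb eu eh}.
set w := s * om; set b := - s + _; set u := (1 - s)^-1; set h := 1 + s / 2 + _ + _.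
have s1' : 0 < 1 - s by lra.
have hu : `|u| <= 2.
  rewrite ger0_norm; last by rewrite invr_ge0 ltW.
  by rewrite /u -[leLHS]div1r ler_pdivrMr //; lra.
have hs : `|s| <= 1 / 2 by rewrite ger0_norm.
have hom : `|om| <= 1 by rewrite ger0_norm.
pose n0 := 1 - w / 2 - w ^+ 2 / 2.
pose p1 := - (3 / 16 * om) - om ^+ 2 / 4 - 3 / 16 * (s * om ^+ 2).
pose B1 := 1 + om.
pose b2 := u + om * (u + u ^+ 2).
pose r2 := be * om * (1 + s * B1 + s ^+ 2 * b2) + (2 - 2 * om) * b2 - om * (B1 + s * b2).
pose r3 := 2 * u + (- 1 + s * be) * om * u.
(* p1 is the cofactor of s^3 left by the product of n0 and the Taylor polynomial of h,
   r2 the remainder of order s^2 of the product of 2 - 2 om + b om and u (1 + w u),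
   and r3 the remainder of order s of (2 + b om) u. *)
pose Rr := n0 * eta + rho * h + p1 - r2 / 4 + (4 * r3 + s * r3 ^+ 2) / 32.
have E : (1 - w / 2 - w ^+ 2 / 2 + s ^+ 3 * rho) * h - 1 -
     ((2 * s + b * w - 2 * w) * u / 4 * (1 + w * u) - ((2 * s + b * w) * u) ^+ 2 / 32)
   = s ^+ 3 * Rr.
  rewrite /Rr /r3 /r2 /b2 /B1 /p1 /n0 /h /b /w /u; field.
  by rewrite gt_eqF.
rewrite E normrM [in leRHS]mulrC normrX (ger0_norm s0) ler_wpM2l ?exprn_ge0 //.
have s3 : `|s ^+ 3| <= 1 / 8.
  rewrite ger0_norm ?exprn_ge0 //; have -> : (1 / 8 : R) = (1 / 2) ^+ 3 by field.
  by rewrite lerXn2r // nnegrE; lra.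
eapply le_trans.
  rewrite /Rr /r3 /r2 /b2 /B1 /p1 /n0 /h /b /w; move: (u) hu => v hv.
  by clear -hv hs hom hbe heta hrho s3; bound_norm.
clear; lra.
Qed.

Lemma ln_1B_bounds (s : R) : 0 <= s -> s <= 1 / 2 -> - s - 2 * s ^+ 2 <= ln (1 - s) <= - s.
Proof.
move=> s0 s1; have p : 0 < 1 - s by lra.
have hp := ln_le_subr1 p.
apply/andP; split; last by move: hp; lra.
have p' : 0 < (1 - s)^-1 by rewrite invr_gt0.
suff : ln ((1 - s)^-1) <= s + 2 * s ^+ 2 by rewrite lnV ?posrE //; lra.
rewrite -ler_expR lnK ?posrE //; apply: le_trans (expR_ge1Dx _).
rewrite -[_^-1]div1r ler_pdivrMr //.
have -> : (1 + (s + 2 * s ^+ 2)) * (1 - s) = 1 + s ^+ 2 * (1 - 2 * s) by ring.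
by rewrite lerDl mulr_ge0 ?sqr_ge0 //; lra.
Qed.

(** With v = sqrt (1-s) and P the Taylor polynomial, (v P)^2 = 1 - s^3 q for an
    explicit q, and 1 - v P = (1 - (v P)^2)/(1 + v P). *)
Lemma inv_sqrt_1B_expansion (s : R) : 0 <= s -> s <= 1 / 2 ->
  exists2 eta, `|eta| <= 4 &
   (Num.sqrt (1 - s))^-1 = 1 + s / 2 + 3 / 8 * s ^+ 2 + s ^+ 3 * eta.
Proof.
move=> s0 s1; have p : 0 < 1 - s by lra.
set v := Num.sqrt _; have v2 : v ^+ 2 = 1 - s by rewrite sqr_sqrtr // ltW.
have v0 : 0 < v by rewrite sqrtr_gt0.
pose P := 1 + s / 2 + 3 / 8 * s ^+ 2.
pose q := 5 / 8 + 15 / 64 * s + 9 / 64 * s ^+ 2.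
have P1 : 1 <= P by rewrite /P; nra.
have vP : 0 < 1 + v * P by rewrite addr_gt0 // mulr_gt0 //; lra.
have v12 : 1 / 2 <= v by nra.
exists (q / (v * (1 + v * P))).
  rewrite ger0_norm; last by rewrite divr_ge0 ?mulr_ge0 ?(ltW v0) ?(ltW vP) // /q; nra.
  rewrite ler_pdivrMr ?mulr_gt0 //; have q1 : q <= 1 by rewrite /q; nra.
  have : v <= v * P by rewrite ler_peMr // ltW.
  nra.
rewrite -/P; have e : s ^+ 3 * q = 1 - (v * P) ^+ 2 by rewrite exprMn v2 /P /q; field.
rewrite mulrA e; field.
by rewrite !gt_eqF.
Qed.
End Expansion.

Section Saddle.
Variable R : realType.

(** exp (2t)/t is continuous and unbounded. *)
Lemma saddle_exists (M : R) : 1 <= M ->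
  \forall x \near +oo, exists2 t : R, M <= t & ln (x : R) = expR t ^+ 2 / t.
Proof.
move=> M1; pose f (t : R) := expR t ^+ 2 / t.
have M0 : 0 < M by lra.
near=> x.
have x1 : expR (f M) <= x by near: x; apply: nbhs_pinfty_ge; exact: num_real.
have x0 : 0 < x by apply: lt_le_trans x1; exact: expR_gt0.
have lx : f M <= ln x by rewrite -ler_expR lnK.
pose T := Num.max M (ln x).
have MT : M <= T by rewrite le_max lexx.
have T1 : 1 <= T by apply: le_trans MT.
have fT : ln x <= f T.
  apply: (@le_trans _ _ T); first by rewrite le_max lexx orbT.
  rewrite ler_pdivlMr; last lra.
  by have := expR_ge1Dx T; move: (expR T) => e he; nra.
have cf : {within `[M, T], continuous f}.
  apply: continuous_in_subspaceT => y; rewrite inE /= in_itv /= => /andP[My _].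
  apply: cvgM.
    by apply: (@continuous_comp _ _ _ expR (fun z => z ^+ 2)); [exact: continuous_expR|exact: exprn_continuous].
  apply: cvgV => //; rewrite gt_eqF //; lra.
have [|t] := @IVT R f M T (ln x) MT cf.
  by rewrite ge_min lx /= le_max fT orbT.
by rewrite in_itv /= => /andP[Mt _] <-; exists t.
Unshelve. all: by end_near. Qed.

Lemma expR2_le : expR (2 : R) <= 16.
Proof.
have h : expR (1 / 2 : R) <= 2.
  by apply: le_trans (expR_le_1D2 _ _) _; lra.
have -> : (2 : R) = 1 / 2 * 4%:R by field.
rewrite expRM_natr; apply: le_trans (_ : 2 ^+ 4 <= _); last lra.
by rewrite lerXn2r // nnegrE ?expR_ge0 //.
Qed.

(** With s = ln t/(2t), the iterated logarithms are ln ln x = 2t (1-s) and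
    ln ln ln x = ln 2 + ln t + ln (1-s), and sqrt 2 * L x = 2 exp t sqrt (1-s). The
    error term s^3 is at most the required one since s <= ln_3 x/ln_2 x. *)
Lemma N_gt0_error_le (t x : R) : large t -> 0 < x -> ln x = expR t ^+ 2 / t ->
  [/\ (0 : R) < (N x)%:R, 0 < L x &
   `| - ln ((N x)%:R / x) / (Num.sqrt 2 * L x) - 1 - g 0 x | <=
     500 * `| (ilog 3 x / ilog 2 x) ^+ 3 |].
Proof.
move=> lt x0 lx; have [t1 _] := lt; have t0 : 0 < t by lra.
have hU := N_upper lt x0 lx; have hL := N_lower lt x0 lx.
set E := expR t in lx hU hL; have E0 : 0 < E by exact: expR_gt0.
set w := t^-1 in hU hL; have w0 : 0 < w by rewrite invr_gt0.
have N0 : (0 : R) < (N x)%:R by apply: lt_le_trans hL; rewrite mulr_gt0 ?expR_gt0.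
pose a := ln t; have a2 : 2 <= a.
  by rewrite -ler_expR lnK ?posrE //; apply: le_trans expR2_le _; lra.
have at_ : a <= t by rewrite ltW // ln_sublinear.
pose s := a * w / 2; have s0 : 0 < s by rewrite divr_gt0 ?mulr_gt0 //; lra.
have s1 : s <= 1 / 2.
  by rewrite /s ler_wpM2r ?invr_ge0 // /w ler_pdivrMr // mul1r.
have us : 0 < 1 - s by lra.
have aE : a = 2 * s * t by rewrite /s /w; field; rewrite gt_eqF.
have l2 : ilog 2 x = 2 * t * (1 - s).
  rewrite /ilog /= lx ln_div ?posrE ?exprn_gt0 // lnXn // expRK -/a aE -[_ *+ 2]mulr_natl.
  by ring.
pose b := ln (1 - s).
have l3 : ilog 3 x = ln 2 + a + b.
  have -> : ilog 3 x = ln (ilog 2 x) by [].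
  by rewrite l2 !lnM ?posrE ?mulr_gt0.
have LE : Num.sqrt 2 * L x = 2 * E * Num.sqrt (1 - s).
  rewrite /L; have -> : ilog 1 x = ln x by [].
  rewrite l2 lx -sqrtrM //.
  have -> : 2 * (E ^+ 2 / t * (2 * t * (1 - s))) = (2 * E) ^+ 2 * (1 - s).
    by field; rewrite gt_eqF.
  by rewrite sqrtrM ?sqr_ge0 // sqrtr_sqr ger0_norm // mulr_ge0 // ltW.
have v0 : 0 < Num.sqrt (1 - s) by rewrite sqrtr_gt0.
split=> //.
  have : 0 < Num.sqrt 2 * L x by rewrite LE !mulr_gt0.
  by rewrite pmulr_rgt0 // sqrtr_gt0.
have gE : g 0 x = (2 * s + b * w - 2 * w) * (1 - s)^-1 / 4 * (1 + w * (1 - s)^-1) - ((2 * s + b * w) * (1 - s)^-1) ^+ 2 / 32.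
  rewrite /g l2 l3 addr0 ln1 aE /w; field.
  by rewrite !gt_eqF.
have [eta heta hE] := inv_sqrt_1B_expansion (ltW s0) s1.
have /andP[b1 b2] := ln_1B_bounds (ltW s0) s1; rewrite -/b in b1 b2.
pose be := (b + s) / s ^+ 2.
have bE : b = - s + s ^+ 2 * be by rewrite /be; field; rewrite gt_eqF.
have hbe : `|be| <= 2.
  have s20 : 0 < s ^+ 2 by rewrite exprn_gt0.
  rewrite ler_norml /be ler_pdivlMr // ler_pdivrMr //; apply/andP; split; lra.
pose om := 2 / a.
have a0 : 0 < a by lra.
have om0 : 0 <= om by rewrite divr_ge0 // ltW.
have om1 : om <= 1 by rewrite ler_pdivrMr // mul1r.
have wE : w = s * om by rewrite /om /s; field; rewrite gt_eqF.
pose D := - ln ((N x)%:R / x).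
have DE : D = ln x - ln (N x)%:R by rewrite /D ln_div ?posrE // opprB.
have D1 : 2 * E - E * (w + w ^+ 2 + 41 * w ^+ 3) <= D.
  have : ln (N x)%:R <= ln x + (- (2 * E) + E * (w + w ^+ 2 + 41 * w ^+ 3)).
    by rewrite -[X in _ <= _ + X]expRK -lnM ?posrE ?expR_gt0 // ler_ln // posrE mulr_gt0 ?expR_gt0.
  rewrite DE; lra.
have D2 : D <= 2 * E - E * (w + w ^+ 2 - 2 * w ^+ 3).
  have : ln x + (- (2 * E) + E * (w + w ^+ 2 - 2 * w ^+ 3)) <= ln (N x)%:R.
    by rewrite -[X in _ + X <= _]expRK -lnM ?posrE ?expR_gt0 // ler_ln // posrE mulr_gt0 ?expR_gt0.
  rewrite DE; lra.
pose rho := (D / (2 * E) - (1 - w / 2 - w ^+ 2 / 2)) / s ^+ 3.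
have s30 : 0 < s ^+ 3 by rewrite exprn_gt0.
have rE : D / (2 * E) = 1 - w / 2 - w ^+ 2 / 2 + s ^+ 3 * rho.
  by rewrite /rho; field; rewrite !gt_eqF.
have ws : w ^+ 3 <= s ^+ 3.
  by rewrite lerXn2r ?nnegrE ?(ltW s0) ?(ltW w0) // wE ler_piMr // ltW.
have hrho : `|rho| <= 21.
  rewrite ler_norml /rho ler_pdivlMr // ler_pdivrMr // !lerBrDr !lerBlDr.
  rewrite ler_pdivlMr ?mulr_gt0 // ler_pdivrMr ?mulr_gt0 //.
  have Ew : E * w ^+ 3 <= E * s ^+ 3 by rewrite ler_wpM2l // ltW.
  have Ew0 : 0 < E * s ^+ 3 by rewrite mulr_gt0.
  apply/andP; split; clear -D1 D2 Ew Ew0; lra.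
have main := expansion_match (ltW s0) s1 om0 om1 hbe heta hrho wE bE (erefl _) (erefl _).
rewrite -hE -gE -rE in main.
rewrite -/D LE invfM mulrA.
apply: (le_trans main).
apply: ler_wpM2l; first by rewrite ler0n.
have l20 : 0 < ilog 2 x by rewrite l2 !mulr_gt0.
have : s <= ilog 3 x / ilog 2 x.
  rewrite ler_pdivlMr // l3 l2.
  have l2b : 0 <= ln 2 + b.
    by rewrite /b -lnM ?posrE // ln_ge0 //; lra.
  have : s * (2 * t * (1 - s)) <= s * (2 * t).
    by rewrite ler_wpM2l ?(ltW s0) // ler_piMr ?mulr_ge0 ?(ltW t0) //; lra.
  by rewrite aE; lra.
move=> sl; apply: le_trans (ler_norm _); rewrite lerXn2r // nnegrE ?(ltW s0) //.
by apply: le_trans sl; exact: ltW.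
Qed.
End Saddle.

Theorem theorem1 (R : realType) :
  exists E : R -> R,
    (E : R -> R^o) =O_ +oo (fun x : R => (ilog 3 x / ilog 2 x) ^+ 3 : R^o) /\
    \forall x \near +oo,
      (N x)%:R =
        x * expR (- (Num.sqrt 2 * L x * (1 + g 0 x + E x))).
Proof.
have [M [Mr HM]] := near_large R.
have M1 : 1 <= Num.max 1 (M + 1) by rewrite le_max lexx.
have key : \forall x \near +oo, [/\ 0 < (x : R), (0 : R) < (N x)%:R, 0 < L x &
   `| - ln ((N x)%:R / x) / (Num.sqrt 2 * L x) - 1 - g 0 x | <=
     500 * `| (ilog 3 x / ilog 2 x) ^+ 3 |].
  near=> x.
  have x0 : 0 < x by near: x; apply: nbhs_pinfty_gt; exact: num_real.
  have [t Mt lx] : exists2 t : R, Num.max 1 (M + 1) <= t & ln x = expR t ^+ 2 / t.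
    by near: x; exact: saddle_exists.
  have lt : large t.
    by apply: HM; apply: lt_le_trans Mt; rewrite lt_max ltrDl ltr01 orbT.
  by have [h1 h2 h3] := N_gt0_error_le lt x0 lx; split.
exists (fun x => - ln ((N x)%:R / x) / (Num.sqrt 2 * L x) - 1 - g 0 x); split.
  apply/eqO_exP; exists 500; first by rewrite ltr0n.
  by near=> x; have [] : [/\ 0 < x, (0 : R) < (N x)%:R, 0 < L x &
   `| - ln ((N x)%:R / x) / (Num.sqrt 2 * L x) - 1 - g 0 x | <=
     500 * `| (ilog 3 x / ilog 2 x) ^+ 3 |] by near: x.
apply: filterS key => x [x0 N0 L0 _].
have s2 : 0 < Num.sqrt 2 * L x by rewrite mulr_gt0 // sqrtr_gt0.
have -> : Num.sqrt 2 * L x * (1 + g 0 x + (- ln ((N x)%:R / x) / (Num.sqrt 2 * L x) - 1 - g 0 x)) =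
   - ln ((N x)%:R / x).
  have -> : 1 + g 0 x + (- ln ((N x)%:R / x) / (Num.sqrt 2 * L x) - 1 - g 0 x) =
     - ln ((N x)%:R / x) / (Num.sqrt 2 * L x) by ring.
  by rewrite mulrC divfK // gt_eqF.
by rewrite opprK lnK ?posrE ?divr_gt0 // mulrC divfK // gt_eqF.
Unshelve. all: by end_near. Qed.
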